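(* Let $G$ be a connected, infinite, locally finite bipartite graph. If $G$ has a perfect matching, then $G^3_B$ has a Hamiltonian circle.
   Context: For a graph $G$ and integer $t\ge1$, $G^t_B$ is the graph on $V(G)$ in which $x,y$ are adjacent iff $d_G(x,y)$ is odd and at most $t$. A graph is locally finite if every vertex has finite degree. A ray is a one-way infinite path; its subrays are its tails. Two rays are equivalent if for every finite $S\subseteq V(G)$ some component of $G-S$ contains tails of both; the equivalence classes are the ends of $G$. For an end $\alpha$ and finite $S$, $C(S,\alpha)$ is the component of $G-S$ containing a tail of every ray in $\alpha$, and $\Omega(S,\alpha)$ is the set of ends $\beta$ with $C(S,\beta)=C(S,\alpha)$. The Freudenthal compactification $|G|$ is the space obtained from $G$ as a 1-complex (each edge a copy of $[0,1]$) together with its ends, where basic open neighbourhoods of an end $\alpha$ are $C(S,\alpha)\cup\Omega(S,\alpha)\cup E(S,\alpha)$ for finite $S$, with $E(S,\alpha)$ the set of inner points of edges between $S$ and $C(S,\alpha)$. A circle is a homeomorphic image of the unit circle $S^1$ in $|G|$; it is a Hamiltonian circle if it contains every vertex of $G$. *)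

(* Defs.v *)
From HB Require Import structures.
From mathcomp Require Import all_boot all_order all_algebra.
From mathcomp Require Import all_classical all_reals all_analysis.
Set Implicit Arguments.
Unset Strict Implicit.
Unset Printing Implicit Defensive.
Import Order.TTheory GRing.Theory Num.Theory.
Import numFieldNormedType.Exports.
Local Open Scope classical_set_scope.
Local Open Scope ring_scope.

Record graph (V : choiceType) := Graph {
  adj :> rel V;
  adj_sym : symmetric adj;
  adj_irr : irreflexive adj }.

Section Graphs.
Context {V : choiceType}.
Implicit Types (G : graph V) (S A C : set V) (x y : V).

Definition joined G A x y : Prop :=
  exists p : seq V,
    [/\ path G x p, last x p = y & forall z, z \in x :: p -> A z].

Definition connected_graph G : Prop := forall x y, joined G setT x y.

Definition locally_finite G : Prop :=
  forall x, finite_set [set y | G x y].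

Definition bipartite G : Prop :=
  exists c : V -> bool, forall x y, G x y -> c x != c y.

(* A set of edges is given as a symmetric subrelation of adjacency. *)
Definition perfect_matching G (M : rel V) : Prop :=
  [/\ symmetric M, (forall x y, M x y -> G x y) &
      forall x, exists! y, M x y].

Definition is_dist G x y (n : nat) : Prop :=
  (exists p, [/\ path G x p, last x p = y & size p = n]) /\
  (forall p, path G x p -> last x p = y -> (n <= size p)%N).

Definition bipower_adj G (t : nat) : rel V :=
  fun x y => `[< exists n, [/\ is_dist G x y n, odd n & (n <= t)%N] >].

Lemma rev_walk G x p : path G x p ->
  exists q, [/\ path G (last x p) q, last (last x p) q = x,
    size q = size p & last x p :: q =i x :: p].
Proof.
move=> xp; exists (rev (belast x p)); split.
- rewrite rev_path; rewrite (@eq_path _ _ G)// => a b.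
  by rewrite /= adj_sym.
- by case: p xp => [|a p] //= _; rewrite rev_cons last_rcons.
- by rewrite size_rev size_belast.
- by move=> z; rewrite [x :: p]lastI mem_rcons !inE mem_rev.
Qed.

Lemma is_dist_sym G x y n : is_dist G x y n -> is_dist G y x n.
Proof.
move=> [[p [xp py pn]] nmin]; split.
  have [q [qp qx qs _]] := rev_walk xp.
  by exists q; rewrite -py qs.
move=> p' yp' p'x; have [q [qp qx qs _]] := rev_walk yp'.
by rewrite -qs; apply: nmin; rewrite -?p'x.
Qed.

Lemma bipower_sym G t : symmetric (bipower_adj G t).
Proof.
by move=> x y; apply/asboolP/asboolP => -[n [/is_dist_sym]]; exists n.
Qed.

Lemma bipower_irr G t : irreflexive (bipower_adj G t).
Proof.
move=> x; apply/asboolP => -[n [[_ /(_ [::] erefl erefl)]]].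
by rewrite leqn0 => /eqP ->.
Qed.

Definition bipower G (t : nat) : graph V :=
  Graph (bipower_sym G t) (bipower_irr G t).

Definition ray G (r : nat -> V) : Prop :=
  injective r /\ forall n, G (r n) (r n.+1).

Definition component G S C : Prop :=
  exists2 x, ~ S x & C = [set y | joined G (~` S) x y].

Definition tail_in (r : nat -> V) C : Prop :=
  exists n, forall m, (n <= m)%N -> C (r m).

Definition ray_equiv G (r r' : nat -> V) : Prop :=
  forall S, finite_set S ->
    exists C, [/\ component G S C, tail_in r C & tail_in r' C].

Definition is_end G (a : set (nat -> V)) : Prop :=
  exists2 r, ray G r & a = [set r' | ray G r' /\ ray_equiv G r r'].

Definition graph_end G := {a : set (nat -> V) | is_end G a}.

(* [set0] is a dummy value, never taken when [S] is finite (see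
   [end_componentP]). *)
Definition end_component G S (a : graph_end G) : set V :=
  xget set0 [set C | component G S C /\
                     forall r, sval a r -> tail_in r C].

Lemma joined_sym G A x y : joined G A x y -> joined G A y x.
Proof.
move=> [p [xp py pA]]; have [q [qp qx _ qE]] := rev_walk xp.
by exists q; rewrite -py; split=> // z; rewrite qE; exact: pA.
Qed.

Lemma joined_trans G A x y z :
  joined G A x y -> joined G A y z -> joined G A x z.
Proof.
move=> [p [xp py pA]] [q [yq qz qA]]; exists (p ++ q).
rewrite cat_path xp py yq last_cat py qz; split=> // u.
rewrite inE mem_cat orbA => /orP[up|uq]; first by apply: pA; rewrite inE.
by apply: qA; rewrite inE uq orbT.
Qed.

Lemma joined_sub G A B x y : A `<=` B -> joined G A x y -> joined G B x y.
Proof. by move=> AB [p [xp py pA]]; exists p; split=> // z /pA/AB. Qed.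

Lemma joined_mem G A x y : joined G A x y -> A y.
Proof. by move=> [p [_ <- pA]]; apply: pA; exact: mem_last. Qed.

Lemma joined_edge G A x y : A x -> A y -> G x y -> joined G A x y.
Proof.
move=> Ax Ay xy; exists [:: y]; split=> //=; first by rewrite xy.
by move=> z; rewrite !inE => /orP[] /eqP ->.
Qed.

Lemma component_step G S C x y :
  component G S C -> C x -> G x y -> ~ S y -> C y.
Proof.
move=> [z Sz ->] /= zx xy Sy; apply: (joined_trans zx).
exact: (joined_edge (joined_mem zx)).
Qed.

Lemma component_disj G S C x : component G S C -> C x -> ~ S x.
Proof. by move=> [z _ ->] /joined_mem. Qed.

(* Components of [G - T] meeting a component [C] of [G - S] lie in [C]
   whenever [S] is contained in [T]. *)
Lemma component_sub G S T C D x : S `<=` T -> component G S C ->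
  component G T D -> C x -> D x -> D `<=` C.
Proof.
move=> ST [c _ ->] [d _ ->] /= cx dx y /= dy.
apply: (joined_trans cx); apply: (@joined_sub _ (~` T)).
  by move=> z Tz /ST.
exact: joined_trans (joined_sym dx) dy.
Qed.

Lemma component_eq G S C D x : component G S C -> component G S D ->
  C x -> D x -> C = D.
Proof.
move=> SC SD Cx Dx; apply/seteqP; split.
  exact: (component_sub (@subset_refl _ S) SD SC Dx Cx).
exact: (component_sub (@subset_refl _ S) SC SD Cx Dx).
Qed.

Lemma tail_in_meet r C D : tail_in r C -> tail_in r D -> exists x, C x /\ D x.
Proof.
move=> [m rC] [n rD]; exists (r (maxn m n)).
by split; [apply: rC; exact: leq_maxl|apply: rD; exact: leq_maxr].
Qed.

Lemma ray_component G r S : ray G r -> finite_set S ->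
  exists2 C, component G S C & tail_in r C.
Proof.
move=> [rI rG] Sfin.
have : finite_set (r @^-1` S).
  by apply: finite_preimage => // i j _ _; exact: rI.
move=> /finite_seqP[s sE].
pose n := (\max_(i <- s) i)%N.+1.
have rS m : (n <= m)%N -> ~ S (r m).
  move=> nm Srm; have ms : m \in s by have : (r @^-1` S) m by []; rewrite sE.
  have : (m < n)%N by rewrite ltnS; exact: (@leq_bigmax_seq _ s xpredT id).
  by rewrite ltnNge nm.
exists [set y | joined G (~` S) (r n) y]; first by exists (r n) => //; exact: rS.
exists n => m nm /=; rewrite -(subnKC nm).
elim: (m - n)%N => [|k IH].
  rewrite addn0; exists [::]; split=> //= z.
  by rewrite inE => /eqP ->; exact: rS.
apply: (joined_trans IH); rewrite addnS.
by apply: joined_edge => //; apply: rS; rewrite -?addnS leq_addr.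
Qed.

Lemma end_componentP G S (a : graph_end G) : finite_set S ->
  component G S (end_component S a) /\
  forall r, sval a r -> tail_in r (end_component S a).
Proof.
move=> Sfin; pose P := [set C | component G S C /\
  forall r, sval a r -> tail_in r C].
suff : exists C, P C by exact: (@xgetPex _ set0 P).
rewrite /P {P}.
case: a => a /= [r0 r0r ->].
have [C SC rC] := ray_component r0r Sfin.
exists C; split=> // r [_ /(_ _ Sfin)[D [SD r0D rD]]].
have [x [Cx Dx]] := tail_in_meet rC r0D.
by rewrite (component_eq SC SD Cx Dx).
Qed.

Lemma graph_end_inhabited G (a : graph_end G) : exists r, sval a r.
Proof.
case: a => a /= [r rr ->]; exists r; split=> // S Sfin.
by have [C SC rC] := ray_component rr Sfin; exists C.
Qed.

Lemma end_component_unique G S (a : graph_end G) C r : finite_set S ->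
  component G S C -> sval a r -> tail_in r C -> C = end_component S a.
Proof.
move=> Sfin SC ar rC; have [SD /(_ _ ar) rD] := end_componentP a Sfin.
by have [x [Cx Dx]] := tail_in_meet rC rD; exact: component_eq SC SD Cx Dx.
Qed.

Lemma end_component_sub G S T (a : graph_end G) :
  finite_set T -> S `<=` T -> end_component T a `<=` end_component S a.
Proof.
move=> Tfin ST; have Sfin := sub_finite_set ST Tfin.
have [SC rC] := end_componentP a Sfin; have [TD rD] := end_componentP a Tfin.
have [r ar] := graph_end_inhabited a.
have [x [Cx Dx]] := tail_in_meet (rC _ ar) (rD _ ar).
exact: (component_sub ST SC TD Cx Dx).
Qed.

End Graphs.

Section Freudenthal.
Context (R : realType) {V : choiceType}.

(* The 1-complex is realized by barycentric coordinates, that is, by functions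
   from [V] to [R]: a vertex is a unit vector, and the edge [xy] is the segment
   between the unit vectors of [x] and [y]. *)
Definition vertex_coord (x : V) : V -> R := fun z => (z == x)%:R.

Definition segment (x y : V) (t : R) : V -> R :=
  fun z => (1 - t) * vertex_coord x z + t * vertex_coord y z.

(* Points of the 1-complex of the subgraph of [G] induced by [C]. *)
Definition in_complex (G : graph V) (C : set V) (f : V -> R) : Prop :=
  (exists2 x, C x & f = vertex_coord x) \/
  (exists x y t, [/\ C x, C y, G x y, 0 <= t <= 1 & f = segment x y t]).

(* Inner points of the edges of [G] between [S] and [C]. *)
Definition in_cut_edge (G : graph V) (S C : set V) (f : V -> R) : Prop :=
  exists x y t, [/\ S x, C y, G x y, 0 < t < 1 & f = segment x y t].

Definition complex (G : graph V) := {f : V -> R | in_complex G setT f}.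

Variant freudenthal (G : graph V) : Type :=
| ComplexPoint of complex G
| EndPoint of graph_end G.

Lemma vertex_in_complex (G : graph V) (x : V) :
  in_complex G setT (vertex_coord x).
Proof. by left; exists x. Qed.

Definition vertex_point (G : graph V) (x : V) : freudenthal G :=
  ComplexPoint (exist _ (vertex_coord x) (vertex_in_complex G x)).

Definition end_nbhd (G : graph V) (S : set V) (a : graph_end G) :
    set (freudenthal G) :=
  fun p => match p with
  | ComplexPoint f => in_complex G (end_component S a) (sval f) \/
                      in_cut_edge G S (end_component S a) (sval f)
  | EndPoint b => end_component S b = end_component S a
  end.

Definition edge_trace (G : graph V) (x y : V) (U : set (freudenthal G)) :
    set R :=
  [set t | exists2 f : complex G, U (ComplexPoint f) & sval f = segment x y t].

(* The 1-complex carries the quotient topology: a set is open if its trace on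
   each closed edge is relatively open. *)
Definition freudenthal_open (G : graph V) (U : set (freudenthal G)) : Prop :=
  (forall x y, G x y ->
     open (edge_trace x y U : set (subspace `[0, 1]%classic))) /\
  (forall a : graph_end G, U (EndPoint a) ->
     exists2 S : set V, finite_set S & end_nbhd S a `<=` U).

Lemma end_nbhd_sub (G : graph V) (S T : set V) (a : graph_end G) :
  finite_set T -> S `<=` T -> end_nbhd T a `<=` end_nbhd S a.
Proof.
move=> Tfin ST; have Sfin := sub_finite_set ST Tfin.
have sub := @end_component_sub _ _ _ _ a Tfin ST.
have [SC rC] := end_componentP a Sfin.
case=> [f|b] /=; last first.
  move=> ba; have [r br] := graph_end_inhabited b.
  have [_ /(_ _ br) rT] := end_componentP b Tfin.
  have [Sb /(_ _ br) rS] := end_componentP b Sfin.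
  have [x [Tx Sx]] := tail_in_meet rT rS.
  by apply: (component_eq Sb SC Sx); apply: sub; rewrite -ba.
case=> [[[x Cx fE]|[x [y [t [Cx Cy xy t01 fE]]]]]|[x [y [t [Tx Cy xy t01 fE]]]]].
- by left; left; exists x => //; exact: sub.
- by left; right; exists x, y, t; split=> //; exact: sub.
- have [Sx|Sx] := pselect (S x).
    by right; exists x, y, t; split=> //; exact: sub.
  left; right; exists x, y, t; split=> //; last first.
  + by move: t01 => /andP[/ltW -> /ltW ->].
  + exact: sub.
  + by apply: (component_step SC (sub _ Cy)) => //; rewrite adj_sym.
Qed.

Lemma freudenthal_openT (G : graph V) : freudenthal_open (@setT (freudenthal G)).
Proof.
split=> [x y xy|a _]; last by exists set0.
apply/open_subspaceP; exists setT; first exact: openT.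
apply/seteqP; split=> t [_ t01]; split=> //=.
have fP : in_complex G setT (segment x y t).
  by right; exists x, y, t; split=> //; move: t01; rewrite /= in_itv.
by exists (exist _ _ fP).
Qed.

Lemma edge_traceI (G : graph V) x y (A B : set (freudenthal G)) :
  edge_trace x y (A `&` B) = edge_trace x y A `&` edge_trace x y B.
Proof.
apply/seteqP; split=> t /=; first by move=> [f [Af Bf] fE]; split; exists f.
move=> [[f Af fE] [g Bg gE]]; exists f => //; split=> //.
suff -> : f = g by [].
by case: f g fE gE {Af Bg} => f fP [g gP] /= fE gE; apply: eq_exist; rewrite fE.
Qed.

Lemma freudenthal_openI (G : graph V) : setI_closed (@freudenthal_open G).
Proof.
move=> A B [Ax Ae] [Bx Be]; split=> [x y xy|a [/Ae[S Sfin SA] /Be[T Tfin TB]]].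
  by rewrite edge_traceI; apply: openI; [exact: Ax|exact: Bx].
have STfin : finite_set (S `|` T) by rewrite finite_setU.
exists (S `|` T) => // p STp; split.
  by apply: SA; exact: (end_nbhd_sub STfin (@subsetUl _ S T) STp).
by apply: TB; exact: (end_nbhd_sub STfin (@subsetUr _ S T) STp).
Qed.

Lemma freudenthal_open_bigU (G : graph V) (I : Type)
    (f : I -> set (freudenthal G)) :
  (forall i, freudenthal_open (f i)) -> freudenthal_open (\bigcup_i f i).
Proof.
move=> fo; split=> [x y xy|a [i _ fia]].
  rewrite (_ : edge_trace x y _ = \bigcup_i edge_trace x y (f i)).
    by apply: bigcup_open => i _; have [/(_ _ _ xy)] := fo i.
  apply/seteqP; split=> t /=.
    by move=> [g [i _ fig] gE]; exists i => //; exists g.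
  by move=> [i _ [g fig gE]]; exists g => //; exists i.
have [_ /(_ _ fia)[S Sfin Sf]] := fo i.
by exists S => // p /Sf; exists i.
Qed.

Lemma segmentE (x y : V) (t : R) (z : V) :
  x != y -> segment x y t z = if z == x then 1 - t else if z == y then t else 0.
Proof.
rewrite /segment /vertex_coord => xy; case: eqVneq => [->|zx].
  by rewrite (negbTE xy) mulr1 mulr0 addr0.
by case: eqVneq => _; rewrite ?(mulr0, mulr1, add0r).
Qed.

Lemma segment_sym (x y : V) (t : R) : segment x y t = segment y x (1 - t).
Proof. by apply/funext => z; rewrite /segment subKr addrC. Qed.

Lemma segment0 (x y : V) : segment x y (0 : R) = vertex_coord x.
Proof. by apply/funext => z; rewrite /segment subr0 mul1r mul0r addr0. Qed.

Lemma adj_neq (G : graph V) x y : G x y -> x != y.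
Proof. by apply: contraTneq => ->; rewrite adj_irr. Qed.

Lemma end_nbhd_complexP (G : graph V) (S : set V) (a : graph_end G)
    (f : complex G) : finite_set S ->
  end_nbhd S a (ComplexPoint f) <->
  exists2 z, end_component S a z & sval f z != 0.
Proof.
move=> Sfin; have [SC _] := end_componentP a Sfin; set C := end_component S a.
rewrite -/C in SC; split=> /=.
  case=> [[[x Cx ->]|[x [y [t [Cx Cy xy t01 ->]]]]]|[x [y [t [Sx Cy xy t01 ->]]]]].
  - by exists x => //; rewrite /vertex_coord eqxx oner_eq0.
  - have [t0|t0] := eqVneq t 0.
      by exists x => //; rewrite segmentE ?(adj_neq xy)// eqxx t0 subr0 oner_eq0.
    exists y => //; rewrite segmentE ?(adj_neq xy)// [y == x]eq_sym.
    by rewrite (negbTE (adj_neq xy)) eqxx.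
  - exists y => //; rewrite segmentE ?(adj_neq xy)// [y == x]eq_sym.
    rewrite (negbTE (adj_neq xy)) eqxx.
    by move: t01 => /andP[/gt_eqF ->].
have main x y t : G x y -> 0 <= t <= 1 -> C x -> t != 1 ->
    in_complex G C (segment x y t) \/ in_cut_edge G S C (segment x y t).
  move=> xy t01 Cx t1; have [t0|t0] := eqVneq t 0.
    by left; left; exists x => //; rewrite t0 segment0.
  have [Sy|Sy] := pselect (S y); last first.
    left; right; exists x, y, t; split=> //; exact: (component_step SC Cx xy).
  right; exists y, x, (1 - t); split=> //; last exact: segment_sym.
    by rewrite adj_sym.
  move: t01 => /andP[t_ge0 t_le1].
  by rewrite subr_gt0 gtrBl !lt_neqAle t1 t_le1 eq_sym t0 t_ge0.
case: f => f /= fP; move: fP => [[x _ ->]|[x [y [t [_ _ xy t01 ->]]]]] [z Cz].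
  have [zx _|zx] := eqVneq z x; first by left; left; exists x; rewrite // -zx.
  by rewrite /vertex_coord (negbTE zx) eqxx.
rewrite segmentE ?(adj_neq xy)//; case: (eqVneq z x) => [zx t1|zx].
  have Cx : C x by rewrite -zx.
  have t1' : t != 1 by apply: contra_neq t1 => ->; rewrite subrr.
  exact: main.
case: (eqVneq z y) => [zy t0|]; last by rewrite eqxx.
have Cy : C y by rewrite -zy.
rewrite segment_sym; apply: main => //; first by rewrite adj_sym.
  by move: t01 => /andP[t_ge0 t_le1]; rewrite subr_ge0 gerBl t_le1.
by apply: contra_neq t0 => t1; rewrite -(subKr 1 t) t1 subrr.
Qed.

Lemma end_nbhd_open (G : graph V) (S : set V) (a : graph_end G) :
  finite_set S -> freudenthal_open (end_nbhd S a).
Proof.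
move=> Sfin; split=> [x y xy|b /= ba]; last first.
  by exists S => // -[f|c] /=; rewrite ba.
set C := end_component S a.
apply/open_subspaceP.
exists ([set t | C x /\ t != 1] `|` [set t | C y /\ t != 0]).
  have op (c : R) (P : Prop) : open [set t : R | P /\ t != c].
    have [p|p] := pselect P; last first.
      by rewrite (_ : mkset _ = set0); [exact: open0|apply/seteqP; split=> t []].
    rewrite (_ : mkset _ = [set t | t != c]); first exact: open_neq.
    by apply/seteqP; split=> t //= [].
  exact: openU.
apply/seteqP; split=> t [H t01]; split=> //=; have := t01; rewrite /= in_itv /= => t01'.
  have fP : in_complex G setT (segment x y t).
    by right; exists x, y, t; split.
  exists (exist _ _ fP) => //.
  apply/(end_nbhd_complexP _ _ Sfin) => /=.
  case: H => -[Cz tz]; [exists x|exists y] => //; rewrite segmentE ?(adj_neq xy)//.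
    by rewrite eqxx subr_eq0 eq_sym.
  by rewrite [y == x]eq_sym (negbTE (adj_neq xy)) eqxx.
case: H => f /(end_nbhd_complexP _ _ Sfin)[z Cz] + fE.
rewrite fE segmentE ?(adj_neq xy)//; case: (eqVneq z x) => [<- t1|zx].
  by left; split=> //; apply: contra_neq t1 => ->; rewrite subrr.
by case: (eqVneq z y) => [<- t0|]; [right|rewrite eqxx].
Qed.

HB.instance Definition _ (G : graph V) := gen_eqMixin (freudenthal G).
HB.instance Definition _ (G : graph V) := gen_choiceMixin (freudenthal G).
HB.instance Definition _ (G : graph V) :=
  isOpenTopological.Build (freudenthal G) (@freudenthal_openT G)
    (@freudenthal_openI G) (@freudenthal_open_bigU G).

End Freudenthal.

Definition unit_circle (R : realType) : set (R * R) :=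
  [set z | z.1 ^+ 2 + z.2 ^+ 2 = 1].

Definition homeomorphic_sets (S T : topologicalType) (A : set S) (B : set T) :
    Prop :=
  exists (f : S -> T) (g : T -> S),
    [/\ set_fun A B f /\ set_fun B A g,
        {in A, cancel f g} /\ {in B, cancel g f},
        {within A, continuous f} & {within B, continuous g}].

Definition circle (R : realType) (T : topologicalType) (C : set T) : Prop :=
  homeomorphic_sets (@unit_circle R) C.

Definition hamiltonian_circle (R : realType) (V : choiceType) (G : graph V)
    (C : set (freudenthal R G)) : Prop :=
  circle R C /\ forall x : V, C (vertex_point R G x).

(* Main.v *)
(* Let H be the bipartite cube of G. Delete the ends of a matching edge xy from a
   connected region closed under the matching: every component C of what is left
   has a vertex u adjacent to x or to y, and C is again such a region, rooted at
   the matching edge at u. Recursively this gives a tree of nested regions, in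
   which a path of H from x to y through the whole region is obtained by
   concatenating paths through the components, each between the two ends of its
   root edge: entering the components at y through their far ends, and those at x
   through their near ends, all connecting steps join the ends of walks of length
   1 or 3. If u is always chosen closest to the vertex of least index in C, then
   every vertex is at some finite depth of the tree.

   On the interval, the path through a region is a self-similar map: the paths
   through the components occupy disjoint subintervals, and the times never
   reached by an edge correspond to the infinite branches of the tree. A region
   has a finite boundary in H, so the regions along a branch shrink to exactly one
   end, and different branches give different ends. The map is thus continuous
   and injective; with the edge yx it closes up to an injective continuous image
   of the circle, which is a homeomorphic one since the circle is compact and |H|
   is Hausdorff. *)
From HB Require Import structures.
Require Import Defs.
From mathcomp Require Import all_boot all_order all_algebra.
From mathcomp Require Import all_classical all_reals all_analysis.
From mathcomp Require Import zify lra.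
Import Order.TTheory GRing.Theory Num.Theory.
Import numFieldNormedType.Exports.
Set Implicit Arguments.
Unset Strict Implicit.
Unset Printing Implicit Defensive.
Local Open Scope classical_set_scope.

(** * Walks and finite boundaries *)

Section Walks.
Context {V : choiceType} (G : graph V).
Implicit Types (A D S : set V) (x y u v w : V).

Definition closed_nbhd A : set V := A `|` [set y | exists2 x, A x & G x y].

Lemma closed_nbhd_finite A :
  locally_finite G -> finite_set A -> finite_set (closed_nbhd A).
Proof.
move=> lf Afin; rewrite finite_setU; split=> //.
rewrite (_ : [set y | _] = \bigcup_(x in A) [set y | G x y]).
  by apply: bigcup_finite => // x _; exact: lf.
by apply/seteqP; split=> y [x Ax xy]; exists x.
Qed.

Lemma iter_closed_nbhd_finite n A :
  locally_finite G -> finite_set A -> finite_set (iter n closed_nbhd A).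
Proof. by move=> lf Afin; elim: n => //= n; exact: closed_nbhd_finite. Qed.

Lemma walk_closed_nbhd n A x p : A x -> path G x p -> (size p <= n)%N ->
  iter n closed_nbhd A (last x p).
Proof.
elim: n A x p => [|n IH] A x [|y p]//=.
  by move=> Ax _ _; left; apply: (IH _ _ [::]).
by move=> Ax /andP[xy yp] pn; rewrite -iterS iterSr; apply: IH => //; right; exists x.
Qed.

(** Every vertex lies in a ball around a fixed one, and balls are finite by local finiteness. The
    indices later select the leaders of regions. *)
Lemma connected_countable : connected_graph G -> locally_finite G ->
  exists idx : V -> nat, injective idx.
Proof.
move=> conn lf; have [[x0 _]|V0] := pselect (exists x : V, True); last first.
  by exists (fun _ => 0%N) => x; case: V0; exists x.
have : countable [set: V].
  rewrite (_ : setT = \bigcup_n iter n closed_nbhd [set x0]).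
    apply: bigcup_countable => // n _; apply: finite_set_countable.
    exact: iter_closed_nbhd_finite.
  apply/seteqP; split=> // y _; have [p [xp py _]] := conn x0 y.
  by exists (size p) => //; rewrite -py; exact: walk_closed_nbhd.
by move=> /countable_injP[f finj]; exists f => x y; apply: finj; rewrite inE.
Qed.

Lemma joined_prefix A x p z : path G x p -> (forall v, v \in x :: p -> A v) ->
  z \in x :: p -> joined G A x z.
Proof.
move=> + + zp; case/splitPl: zp => p1 p2 p1z; rewrite cat_path => /andP[xp1 _] pA.
exists p1; split=> // v; rewrite inE => vp; apply: pA.
by rewrite inE mem_cat orbA vp.
Qed.

Lemma joined_refl A x : A x -> joined G A x x.
Proof. by move=> Ax; exists [::]; split=> // z; rewrite inE => /eqP ->. Qed.

Lemma joined_class A u x y : joined G A u x -> joined G A u y ->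
  joined G [set v | joined G A u v] x y.
Proof.
move=> ux uy; have [p [xp py pA]] := joined_trans (joined_sym ux) uy.
by exists p; split=> // z zp; exact: (joined_trans ux (joined_prefix xp pA zp)).
Qed.

Lemma bipower_walk t x y : bipower G t x y ->
  exists p, [/\ path G x p, last x p = y & (size p <= t)%N].
Proof.
by move=> /asboolP[n [[[p [xp py pn]] _] _ nt]]; exists p; split; rewrite // pn.
Qed.

(** In a bipartite graph all walks between two given vertices have the same parity, so one odd walk
    makes their distance odd. *)
Lemma walk_bipower t x p : bipartite G -> path G x p -> odd (size p) ->
  (size p <= t)%N -> bipower G t x (last x p).
Proof.
move=> [c cG] xp podd pt.
have col z q : path G z q -> c (last z q) = c z (+) odd (size q).
  elim: q z => [|a q IH] z /=; first by rewrite addbF.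
  move=> /andP[/cG zc /IH ->]; rewrite addbN -addNb; congr (_ (+) _).
  by move: zc; case: (c z); case: (c a).
pose P n := `[< exists q, [/\ path G x q, last x q = last x p & size q = n] >].
have exP : exists n, P n by exists (size p); apply/asboolP; exists p.
case: (ex_minnP exP) => n /asboolP[q [xq qp qn]] nmin.
have np : (n <= size p)%N by apply: nmin; apply/asboolP; exists p.
apply/asboolP; exists n; split; last exact: leq_trans pt.
  split; first by exists q.
  by move=> r xr rp; apply: nmin; apply/asboolP; exists r.
have := col _ _ xp; rewrite -qp (col _ _ xq) qn podd.
by case: (c x); case: (odd n).
Qed.

Lemma bipower_nbr_finite t x : locally_finite G ->
  finite_set [set y | bipower G t x y].
Proof.
move=> lf; apply: (sub_finite_set _ (iter_closed_nbhd_finite t lf (finite_set1 x))).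
by move=> y /bipower_walk[p [xp <- pt]]; exact: walk_closed_nbhd.
Qed.

Definition outer_boundary D : set V := [set w | ~ D w /\ exists2 v, D v & G v w].

Lemma walk_exit D x p : path G x p -> D x -> ~ D (last x p) ->
  exists p1 p2, [/\ p = p1 ++ p2, path G x p1 & outer_boundary D (last x p1)].
Proof.
elim: p x => [|a p IH] x //= /andP[xa ap] Dx Dl.
have [Da|Da] := pselect (D a); last first.
  by exists [:: a], p; split; rewrite //= ?xa //; split=> //; exists x.
have [p1 [p2 [-> ap1 p1D]]] := IH _ ap Da Dl.
by exists (a :: p1), p2; split; rewrite //= xa.
Qed.

(** A walk of length at most [t] leaving [D] meets the outer boundary; read backwards, its initial
    part puts [u] in the [t]-th neighbourhood of a finite set. *)
Lemma bipower_boundary_finite t D : locally_finite G ->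
  finite_set (outer_boundary D) ->
  finite_set [set u | D u /\ exists2 w, ~ D w & bipower G t u w].
Proof.
move=> lf Dfin; apply: (sub_finite_set _ (iter_closed_nbhd_finite t lf Dfin)).
move=> u [Du [w Dw /bipower_walk[p [up pw pt]]]].
have [|p1 [p2 [pE up1 p1D]]] := walk_exit up Du; first by rewrite pw.
have [q [p1q qu qs _]] := rev_walk up1.
rewrite -qu; apply: walk_closed_nbhd => //.
by rewrite qs; apply: leq_trans pt; rewrite pE size_cat leq_addr.
Qed.

End Walks.

(** * Trees of nested regions *)

Section Linked.
Context {V : choiceType} (H : rel V) {N : Type} (src tgt : N -> V).

(** Only the connecting steps are required; the passage from [src f] to [tgt f] is left to the arc
    of [f]. *)
Fixpoint linked (a : V) (L : seq N) (b : V) : Prop :=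
  if L is f :: L' then H a (src f) /\ linked (tgt f) L' b else H a b.

End Linked.

Section Visits.
Context {V : choiceType} {N : choiceType} (src tgt : N -> V) (kids : N -> seq N).

Fixpoint visits (n : nat) (e : N) (v : V) : Prop :=
  [\/ v = src e, v = tgt e |
      if n is m.+1 then exists2 f, f \in kids e & visits m f v else False].

End Visits.

(* A node [e] stands for an arc through its whole region from [src e] to [tgt e].
   The last three fields make the regions along an infinite branch close down on
   exactly one end. *)
Record arc_tree (V : choiceType) (H : graph V) := ArcTree {
  node : choiceType;
  src : node -> V;
  tgt : node -> V;
  region : node -> set V;
  kids : node -> seq node;
  region_src : forall e, region e (src e);
  region_tgt : forall e, region e (tgt e);
  src_adj_tgt : forall e, H (src e) (tgt e);
  src_adj_kid : forall e f, f \in kids e -> H (src e) (src f);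
  kids_linked : forall e, linked H src tgt (src e) (kids e) (tgt e);
  region_kid : forall e f, f \in kids e ->
    [/\ region f `<=` region e, ~ region f (src e) & ~ region f (tgt e)];
  kids_uniq : forall e, uniq (kids e);
  kids_disjoint : forall e f g, f \in kids e -> g \in kids e -> f != g ->
    region f `&` region g = set0;
  region_joined : forall e u v, region e u -> region e v ->
    joined H (region e) u v;
  region_boundary : forall e,
    finite_set [set u | region e u /\ exists2 w, ~ region e w & H u w];
  region_visits : forall e v, region e v ->
    exists n, visits src tgt kids n e v }.

(** * The tree of a perfect matching *)

Section MatchingTree.
Context {V : choiceType} (G : graph V) (m : V -> V) (idx : V -> nat).
Hypotheses (lf : locally_finite G) (bip : bipartite G).
Hypotheses (mG : forall x, G x (m x)) (mK : involutive m) (idx_inj : injective idx).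
Implicit Types (D : set V) (x y u v w : V).

(* A triple [e] is read as (region, start, end). *)
Record matched_region (e : set V * V * V) : Prop := MatchedRegion {
  matched_src : e.1.1 e.1.2;
  matched_tgt : e.2 = m e.1.2;
  matched_closed : forall v, e.1.1 v -> e.1.1 (m v);
  matched_joined : forall u v, e.1.1 u -> e.1.1 v -> joined G e.1.1 u v;
  matched_outer : finite_set (outer_boundary G e.1.1) }.

(** The walk must stay in the region: this is the bound that drops by one on passing to the kid
    containing the leader. *)
Definition within_steps (e : set V * V * V) w n : Prop :=
  exists a p, [/\ a = e.1.2 \/ a = e.2, path G a p, last a p = w,
    (size p <= n)%N & forall z, z \in a :: p -> e.1.1 z].

Lemma least_index D : D !=set0 ->
  exists w, D w /\ forall v, D v -> (idx w <= idx v)%N.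
Proof.
move=> [v Dv]; pose P n := `[< exists2 w, D w & idx w = n >].
have exP : exists n, P n by exists (idx v); apply/asboolP; exists v.
case: (ex_minnP exP) => n /asboolP[w Dw <-] nmin; exists w; split=> // u Du.
by apply: nmin; apply/asboolP; exists u.
Qed.

Definition inner (e : set V * V * V) : set V := e.1.1 `\` [set e.1.2; e.2].

Lemma matched_tgt_region e : matched_region e -> e.1.1 e.2.
Proof. by case=> De -> De' _ _; exact: De'. Qed.

(** On a shortest walk inside the region from the root edge to [v], only the starting vertex lies on
    the root edge. *)
Lemma first_step e v : matched_region e -> inner e v ->
  exists u p, [/\ G e.1.2 u \/ G e.2 u, path G u p, last u p = v,
    forall z, z \in u :: p -> inner e z &
    forall n, within_steps e v n.+1 -> (size p <= n)%N].
Proof.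
move=> eM [Dv vNe].
pose P n := `[< within_steps e v n >].
have exP : exists n, P n.
  have [p [xp pv pD]] := matched_joined eM (matched_src eM) Dv.
  by exists (size p); apply/asboolP; exists e.1.2, p; split=> //; left.
case: (ex_minnP exP) => n /asboolP[a [p [ae ap pv pn pD]]] nmin.
case: p => [|u p] in ap pv pn pD *.
  by case: vNe; rewrite -pv /=; case: ae => ->; [left|right].
move: ap => /= /andP[au up].
exists u, p; split=> //.
- by case: ae => <-; [left|right].
- move=> z zp; split; first by apply: pD; rewrite inE zp orbT.
  (* A return to the root edge would leave a shorter walk. *)
  move=> ze; case/splitPl: zp => p1 p2 p1z in up pv pn pD *.
  have : (n <= size p2)%N.
    apply: nmin; apply/asboolP; exists z, p2; split.
    - by case: ze => ->; [left|right].
    - by move: up; rewrite cat_path p1z => /andP[].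
    - by rewrite -pv /= last_cat p1z.
    - by [].
    move=> y; rewrite inE => /orP[/eqP ->|yp2]; apply: pD.
      by rewrite inE -cat_cons mem_cat -p1z mem_last orbT.
    by rewrite inE inE mem_cat yp2 !orbT.
  move: pn; rewrite /= size_cat; lia.
- move=> k kv; have : (n <= k.+1)%N by apply: nmin; apply/asboolP.
  by move: pn => /= pn nk; rewrite -ltnS; exact: leq_trans pn nk.
Qed.

(** A matching edge is deleted as a whole, so the component stays closed under [m]. Its root edge is
    put at the first vertex [u] of a shortest walk to [w], if [w] is in the component; this gains
    one step. If [u] is adjacent to the far end of the old root edge it becomes the far end,
    otherwise the near end. *)
Lemma kid_exists e w u0 : matched_region e -> inner e u0 ->
  exists f, [/\ matched_region f,
    f.1.1 = [set v | joined G (inner e) u0 v],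
    G e.2 f.2 \/ G e.1.2 f.1.2 &
    f.1.1 w -> forall n, within_steps e w n.+1 -> within_steps f w n].
Proof.
move=> eM u0e; pose C := [set v | joined G (inner e) u0 v].
have Ce z : C z -> inner e z by exact: joined_mem.
have inner_m z : inner e z -> inner e (m z).
  have De2 := matched_tgt eM.
  move=> [Dz ze]; split; first exact: matched_closed.
  by move=> [/= zE|/= zE]; apply: ze; [right|left];
    rewrite /= ?De2 -?zE ?mK //; rewrite -[z]mK zE De2 mK.
have Cm z : C z -> C (m z).
  move=> Cz; apply: (joined_trans Cz); apply: joined_edge => //.
    exact: Ce.
  by apply: inner_m; exact: Ce.
have [v [Cv vw]] : exists v, C v /\ (C w -> v = w).
  have [Cw|Cw] := pselect (C w); first by exists w.
  by exists u0; split=> //; exact: joined_refl.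
have [u [p [eu up pv pe pmin]]] := first_step eM (Ce _ Cv).
have Cu : C u.
  apply: (joined_trans Cv); apply: joined_sym; exists p; split=> //.
have Cp z : z \in u :: p -> C z.
  by move=> zp; exact: (joined_trans Cu (joined_prefix up pe zp)).
(* A neighbour of [C] inside the old region can only be an end of the old root edge. *)
have Cout : finite_set (outer_boundary G C).
  apply: (@sub_finite_set _ _ (outer_boundary G e.1.1 `|` [set e.1.2; e.2])).
    move=> z [Cz [y Cy yz]].
    have [Dz|Dz] := pselect (e.1.1 z); last first.
      by left; split=> //; exists y => //; have [] := Ce _ Cy.
    right; apply: contrapT => ze; apply: Cz; apply: (joined_trans Cy).
    by apply: joined_edge => //; exact: Ce.
  by rewrite finite_setU; split; [exact: matched_outer|exact: finite_set2].
have good f : f.1.1 = C -> f.2 = m f.1.2 -> C f.1.2 -> matched_region f.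
  case: f => [[D x] y] /= -> -> Cx; split=> //= a b Ca Cb.
  exact: joined_class.
have near f : f.1.1 = C -> f.1.2 = u \/ f.2 = u ->
    f.1.1 w -> forall n, within_steps e w n.+1 -> within_steps f w n.
  move=> fC fu; rewrite fC => /vw vE n; rewrite -vE => /pmin pn.
  by exists u, p; split=> //; rewrite ?fC //; case: fu => ->; [left|right].
have [yu|yu] := pselect (G e.2 u).
  exists (C, m u, u); split=> //.
  - by apply: good => //=; exact: Cm.
  - by left.
  - by apply: near => //; right.
exists (C, u, m u); split=> //.
- exact: good.
- by right; case: eu.
- by apply: near => //; left.
Qed.

(** By [first_step] every component of the inner part contains one of the finitely many neighbours
    of the root edge. *)
Lemma class_finite e : matched_region e ->
  finite_set [set C : set V | exists2 u, inner e u & C = [set v | joined G (inner e) u v]].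
Proof.
move=> eM; pose A := [set u | G e.1.2 u] `|` [set u | G e.2 u].
apply: (@sub_finite_set _ _ ((fun u => [set v | joined G (inner e) u v]) @` A)).
  move=> C [v ve ->]; have [u [p [eu up pv pe _]]] := first_step eM ve.
  exists u; first by case: eu; [left|right].
  have uv : joined G (inner e) u v by exists p.
  apply/seteqP; split=> z /=; first exact: (joined_trans (joined_sym uv)).
  exact: joined_trans.
by apply: finite_image; rewrite finite_setU; split; exact: lf.
Qed.

Lemma bipower3_edge x y : G x y -> bipower G 3 x y.
Proof. by move=> xy; apply: (@walk_bipower _ G 3 x [:: y]) => //=; rewrite xy. Qed.

Lemma bipower3_walk x a b y : G x a -> G a b -> G b y -> bipower G 3 x y.
Proof.
move=> xa ab bY; apply: (@walk_bipower _ G 3 x [:: a; b; y]) => //=.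
by rewrite xa ab bY.
Qed.

Definition region_node : Type := {e : set V * V * V | `[< matched_region e >]}.
HB.instance Definition _ := Choice.on region_node.

Definition nreg (e : region_node) : set V := (val e).1.1.
Definition nsrc (e : region_node) : V := (val e).1.2.
Definition ntgt (e : region_node) : V := (val e).2.

Lemma nodeM (e : region_node) : matched_region (val e).
Proof. by apply/asboolP; exact: (valP e). Qed.

Lemma nsrc_adj_ntgt e : G (nsrc e) (ntgt e).
Proof. by rewrite /ntgt (matched_tgt (nodeM e)); exact: mG. Qed.

(* The kids hanging off the far end [y] come first and are entered at their far
   ends, so that consecutive ends are always joined by a walk of length 1 or 3. *)
Lemma linked_kids (x y : V) (Ly Lx : seq region_node) a :
  G x y -> (forall f, f \in Ly -> G y (ntgt f)) ->
  (forall f, f \in Lx -> G x (nsrc f)) -> G y a ->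
  linked (bipower G 3) nsrc ntgt a (Ly ++ Lx) y.
Proof.
move=> xy + Lxx; have sG := adj_sym G.
elim: Ly a => [|f Ly IH] a Lyy ya /=; last first.
  have yf : G y (ntgt f) by apply: Lyy; rewrite mem_head.
  split; last by apply: IH => // g gL; apply: Lyy; rewrite inE gL orbT.
  by apply: (bipower3_walk (a := y) (b := ntgt f)); rewrite // sG ?nsrc_adj_ntgt.
have : exists2 b, G a b & G b x by exists y; rewrite sG.
elim: Lx Lxx a {ya} => [|f Lx IH] Lxx a [b ab bx] /=.
  exact: (bipower3_walk ab bx xy).
have xf : G x (nsrc f) by apply: Lxx; rewrite mem_head.
split; first exact: (bipower3_walk ab bx xf).
apply: IH => [g gL|]; first by apply: Lxx; rewrite inE gL orbT.
by exists (nsrc f); rewrite sG // nsrc_adj_ntgt.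
Qed.

(** One node is chosen for each component of the inner part, those hanging off the far end coming
    first. The vertex [w] becomes the leader of [e] in [nkids]. *)
Lemma kids_exist (e : region_node) (w : V) : exists L : seq region_node,
  [/\ forall f, f \in L -> nreg f `<=` inner (val e),
      forall v, inner (val e) v -> exists2 f, f \in L & nreg f v,
      uniq L /\ (forall f g, f \in L -> g \in L -> f != g -> nreg f `&` nreg g = set0),
      linked (bipower G 3) nsrc ntgt (nsrc e) L (ntgt e) &
      forall f, f \in L -> bipower G 3 (nsrc e) (nsrc f) /\
        (nreg f w -> forall n, within_steps (val e) w n.+1 -> within_steps (val f) w n)].
Proof.
have eM := nodeM e.
have [cs0 csE] := (finite_seqP _).1 (class_finite eM).
pose cs := undup cs0.
have csP C : C \in cs -> exists2 u, inner (val e) u & C = [set v | joined G (inner (val e)) u v].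
  by rewrite mem_undup => Ccs; have : [set` cs0] C by []; rewrite -csE.
pose P C (f : region_node) := [/\ nreg f = C,
  G (ntgt e) (ntgt f) \/ G (nsrc e) (nsrc f) &
  (nreg f w -> forall n, within_steps (val e) w n.+1 -> within_steps (val f) w n)].
pose F C := xget e (P C).
have FP C : C \in cs -> P C (F C).
  move=> /csP[u ue CE]; apply: xgetPex.
  have [f [fM fC fadj fnear]] := kid_exists w eM ue.
  by exists (exist _ f (asboolT fM)); split=> //; rewrite CE.
pose L0 := map F cs.
have L0P f : f \in L0 -> P (nreg f) f /\ nreg f \in cs.
  move=> /mapP[C Ccs ->]; have [FC h1 h2] := FP _ Ccs; rewrite [nreg _]FC.
  by split.
have L0u : uniq L0.
  rewrite map_inj_in_uniq ?undup_uniq // => C C' /FP[CE _ _] /FP[CE' _ _] FE.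
  by rewrite -[LHS]CE FE CE'.
pose py := fun f : region_node => G (ntgt e) (ntgt f).
pose L := seq.filter py L0 ++ seq.filter (predC py) L0.
have LL0 f : (f \in L) = (f \in L0).
  by rewrite mem_cat !mem_filter -andb_orl /= orbN.
have disj f g : f \in L0 -> g \in L0 -> f != g -> nreg f `&` nreg g = set0.
  move=> fL gL fg; apply/seteqP; split=> // z [fz gz].
  move/mapP: fL gL => [C Cs fE] /mapP[C' Cs' gE].
  have [FC _ _] := FP _ Cs; have [FC' _ _] := FP _ Cs'.
  move: fz gz fg; rewrite fE gE FC FC' => Cz Cz'.
  suff -> : C = C' by rewrite eqxx.
  have [u ue CE] := csP _ Cs; have [u' ue' CE'] := csP _ Cs'.
  move: Cz Cz'; rewrite CE CE' /= => uz uz'.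
  have uu' := joined_trans uz (joined_sym uz').
  apply/seteqP; split=> v /=; first exact: (joined_trans (joined_sym uu')).
  exact: joined_trans.
exists L; split.
- by move=> f; rewrite LL0 => /L0P[_ /csP[u ue ->]] z /joined_mem.
- move=> v ve; pose C := [set z | joined G (inner (val e)) v z].
  have Ccs : C \in cs.
    rewrite mem_undup; suff : [set` cs0] C by [].
    by rewrite -csE; exists v.
  exists (F C); first by rewrite LL0; exact: map_f.
  by have [-> _ _] := FP _ Ccs; exact: joined_refl.
- split; first by rewrite (perm_uniq (permEl (perm_filterC py L0))).
  by move=> f g; rewrite !LL0; exact: disj.
- apply: linked_kids; first exact: nsrc_adj_ntgt.
  + by move=> f; rewrite mem_filter => /andP[].
  + move=> f; rewrite mem_filter => /andP[/= /negP fy].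
    by move=> /L0P[[_ [/fy|]]].
  + by rewrite (adj_sym G); exact: nsrc_adj_ntgt.
- move=> f; rewrite LL0 => /L0P[[_ fadj fnear] _]; split=> //.
  have [xf|xf] := boolP (G (nsrc e) (nsrc f)); first exact: bipower3_edge.
  case: fadj => [yf|]; last by move=> h; rewrite h in xf.
  (* The walk of length 3 uses the root edges of both [e] and [f]. *)
  apply: (bipower3_walk (nsrc_adj_ntgt e) yf); rewrite (adj_sym G); exact: nsrc_adj_ntgt.
Qed.

Definition leader (e : region_node) : V :=
  xget (nsrc e) [set w | nreg e w /\ forall v, nreg e v -> (idx w <= idx v)%N].

Lemma leaderP e : nreg e (leader e) /\
  forall v, nreg e v -> (idx (leader e) <= idx v)%N.
Proof.
apply: (@xgetPex _ (nsrc e) [set w | nreg e w /\ forall v, nreg e v -> (idx w <= idx v)%N]).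
by apply: least_index; exists (nsrc e); exact: matched_src (nodeM e).
Qed.

Definition nkids (e : region_node) : seq region_node :=
  projT1 (cid (kids_exist e (leader e))).

Lemma within_steps_ex e : exists n, within_steps (val e) (leader e) n.
Proof.
have eM := nodeM e; have [De _] := leaderP e.
have [p [xp pv pD]] := matched_joined eM (matched_src eM) De.
by exists (size p), (nsrc e), p; split=> //; left.
Qed.

(* A kid either keeps the leader, which is then one step closer to its root
   edge, or has a leader of larger index. *)
Lemma nreg_visits e v : nreg e v -> exists n, visits nsrc ntgt nkids n e v.
Proof.
have [k ek] : exists k, (idx v < k + idx (leader e))%N by exists (idx v).+1; lia.
have [d ed] := within_steps_ex e.
(* The outer induction is on [k], which bounds how far the index of [v] is above that of the leader;
   the inner one is on the distance [d] from the root edge to the leader. *)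
elim: k d e ek ed => [|k IHk] d e.
  by move=> ve _ /(leaderP e).2; rewrite add0n in ve; rewrite leqNgt ve.
elim: d e => [|d IHd] e ek ed ev.
all: have [ve|ve] := pselect (v = nsrc e \/ v = ntgt e).
1,3: exists 0%N; by case: ve => ->; [constructor 1|constructor 2].
all: have vi : inner (val e) v by split.
all: have := projT2 (cid (kids_exist e (leader e))).
all: move=> [sub cov _ _ steps].
all: have [f fe fv] := cov _ vi.
all: suff [n fn] : exists n, visits nsrc ntgt nkids n f v by
  exists n.+1; constructor 3; exists f.
all: have [fw|fw] := pselect (nreg f (leader e)).
all: have [De emin] := leaderP e; have [Df fmin] := leaderP f.
(* With [d = 0] the leader is on the root edge, so no kid contains it. *)
- have [_] := sub _ fe _ fw; case.
  have [a [p [ae _ pw pn _]]] := ed; case: p pw pn => //= <- _.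
  by case: ae => ->; [left|right].
- have lef : (idx (leader e) < idx (leader f))%N.
    rewrite ltn_neqAle (emin _ (sub _ fe _ Df).1) andbT.
    by apply/eqP => /idx_inj ef; rewrite ef in fw.
  have [n fn] := within_steps_ex f.
  by apply: (IHk n) => //; move: ek lef; lia.
- have fE : leader f = leader e.
    apply: idx_inj; apply/eqP; rewrite eqn_leq fmin //.
    by rewrite (emin _ (sub _ fe _ Df).1).
  apply: IHd; rewrite ?fE //; exact: (steps _ fe).2.
- have lef : (idx (leader e) < idx (leader f))%N.
    rewrite ltn_neqAle (emin _ (sub _ fe _ Df).1) andbT.
    by apply/eqP => /idx_inj ef; rewrite ef in fw.
  have [n fn] := within_steps_ex f.
  by apply: (IHk n) => //; move: ek lef; lia.
Qed.

Definition matching_tree : arc_tree (bipower G 3).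
Proof.
refine (@ArcTree V (bipower G 3) region_node nsrc ntgt nreg nkids
  _ _ _ _ _ _ _ _ _ _ nreg_visits).
- by move=> e; exact: matched_src (nodeM e).
- by move=> e; exact: matched_tgt_region (nodeM e).
- by move=> e; apply: bipower3_edge; exact: nsrc_adj_ntgt.
- move=> e f fe; have [_ _ _ _ h] := projT2 (cid (kids_exist e (leader e))).
  exact: (h _ fe).1.
- by move=> e; have [_ _ _ h _] := projT2 (cid (kids_exist e (leader e))).
- move=> e f fe; have [h _ _ _ _] := projT2 (cid (kids_exist e (leader e))).
  split=> [z /(h _ fe)[]//|/(h _ fe)[_]|/(h _ fe)[_]]; apply; [by left|by right].
- by move=> e; have [_ _ [h _] _ _] := projT2 (cid (kids_exist e (leader e))).
- by move=> e; have [_ _ [_ h] _ _] := projT2 (cid (kids_exist e (leader e))).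
- move=> e u v eu ev; have [p [up pv pD]] := matched_joined (nodeM e) eu ev.
  exists p; split=> //; apply: sub_path up; exact: bipower3_edge.
- move=> e; apply: bipower_boundary_finite => //; exact: matched_outer (nodeM e).
Defined.

End MatchingTree.

(** * The Freudenthal compactification *)

Section Space.
Local Open Scope ring_scope.
Context (R : realType) {V : choiceType} (H : graph V).
Implicit Types (p q : freudenthal R H) (u v z : V) (s t : R) (A : set V).

(** Barycentric coordinates, extended by 0 to the ends. They separate the points of the complex from
    each other and from the ends. *)
Definition weight z p : R :=
  if p is ComplexPoint f then sval f z else 0.

Lemma complex_eq (f g : complex R H) : sval f = sval g -> f = g.
Proof. by case: f g => f fP [g gP] /= E; apply: eq_exist. Qed.

Lemma complex_nonzero (f : complex R H) : exists z, sval f z != 0.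
Proof.
case: f => f /= [[x _ ->]|[x [y [t [_ _ xy t01 ->]]]]].
  by exists x; rewrite /vertex_coord eqxx oner_eq0.
have nxy := adj_neq xy; have [t0|t0] := eqVneq t 0.
  by exists x; rewrite segmentE // eqxx t0 subr0 oner_eq0.
by exists y; rewrite segmentE // [y == x]eq_sym (negbTE nxy) eqxx.
Qed.

Lemma complex_adj (f : complex R H) u v :
  sval f u != 0 -> sval f v != 0 -> u = v \/ H u v.
Proof.
case: f => f /= [[x _ ->]|[x [y [t [_ _ xy t01 ->]]]]].
  rewrite /vertex_coord; case: (eqVneq u x) => [->|]; last by rewrite eqxx.
  by case: (eqVneq v x) => [->|]; [left|rewrite eqxx].
have nxy := adj_neq xy; rewrite !segmentE //.
have yx : H y x by rewrite (adj_sym H).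
case: (eqVneq u x) => [->|_]; case: (eqVneq v x) => [->|_]; try by left.
- by case: (eqVneq v y) => [->|]; [right|rewrite eqxx].
- by case: (eqVneq u y) => [->|]; [right|rewrite eqxx].
- case: (eqVneq u y) => [->|]; last by rewrite eqxx.
  by case: (eqVneq v y) => [->|]; [left|rewrite eqxx].
Qed.

Lemma edge_trace_preimage (z x y : V) (U : set R) : H x y ->
  edge_trace x y (weight z @^-1` U : set (freudenthal R H)) =
  `[0, 1]%classic `&` (fun t => segment x y t z) @^-1` U.
Proof.
move=> xy; have nxy := adj_neq xy; apply/seteqP; split=> t.
  move=> [f /= Uf fE]; split; last by rewrite /= -fE.
  (* The coordinate of [y] is [t], so a bound on all coordinates confines the trace to the unit
     interval. *)
  have coord01 (w : V) : 0 <= sval f w <= 1.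
    case: f {Uf} fE => f /= [[a _ ->]|[a [b [s [_ _ ab s01 ->]]]]] _.
      by rewrite /vertex_coord; case: eqP => _ /=; lra.
    rewrite segmentE ?(adj_neq ab) //.
    by case: ifP => _; [lra|case: ifP => _; lra].
  have := coord01 y; rewrite fE segmentE // [y == x]eq_sym (negbTE nxy) eqxx.
  by rewrite /= in_itv.
move=> [t01 Ut]; have fP : in_complex H setT (segment x y t).
  by right; exists x, y, t; split=> //; move: t01; rewrite /= in_itv.
by exists (exist _ _ fP).
Qed.

Lemma segment_continuous (x y z : V) : continuous (fun t : R => segment x y t z).
Proof.
move=> t; rewrite /segment.
apply: cvgD; apply: cvgM.
- by apply: cvgB; [exact: cvg_cst|exact: cvg_id].
- exact: cvg_cst.
- exact: cvg_id.
- exact: cvg_cst.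
Qed.

Lemma openE_freudenthal (U : set (freudenthal R H)) :
  open U = freudenthal_open U.
Proof. by []. Qed.

(** At an end, take [S] to be [z] with its neighbours: a point near the end has a nonzero coordinate
    at a vertex outside [S], hence coordinate 0 at [z]. *)
Lemma weight_continuous z : (forall x, finite_set [set y | H x y]) ->
  continuous (weight z).
Proof.
move=> lf; apply/continuousP => U Uo; rewrite openE_freudenthal; split.
  move=> x y xy; rewrite edge_trace_preimage //.
  apply/open_subspaceP; exists ((fun t => segment x y t z) @^-1` U).
    by move/continuousP: (@segment_continuous x y z); apply.
  by rewrite setIC setIAC setIid.
move=> a U0; pose S := z |` [set y | H z y].
have Sfin : finite_set S by rewrite finite_setU; split; [exact: finite_set1|exact: lf].
exists S => // -[f|b] // /(end_nbhd_complexP _ _ Sfin)[w Cw fw].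
rewrite /= (_ : sval f z = 0) //; apply/eqP; apply: contrapT => /negP fz.
have [SC _] := end_componentP a Sfin; have Sw := component_disj SC Cw.
by apply: Sw; have [<-|zw] := complex_adj fz fw; [left|right].
Qed.

(** Coordinates separate all pairs except two ends; these are separated by a finite set giving them
    different components. *)
Lemma freudenthal_hausdorff : (forall x, finite_set [set y | H x y]) ->
  hausdorff_space (freudenthal R H).
Proof.
move=> lf; rewrite open_hausdorff => p q pq.
have [[z pqz]|same] := pselect (exists z, weight z p != weight z q).
  have : hausdorff_space R := @norm_hausdorff R R.
  rewrite open_hausdorff => /(_ _ _ pqz)[[A B]] [/=].
  rewrite !inE => Ap Bq [Ao Bo AB0].
  exists (weight z @^-1` A, weight z @^-1` B); rewrite /= ?inE //.
  have /continuousP cont := weight_continuous (z := z) lf.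
  split; [exact: cont|exact: cont|].
  by rewrite -preimage_setI AB0 preimage_set0.
have {}same z : weight z p = weight z q.
  by apply/eqP; apply: contrapT => /negP pqz; apply: same; exists z.
case: p q pq same => [f|a] [g|b] pq same.
- case/eqP: pq; congr ComplexPoint; apply: complex_eq; apply/funext.
  exact: same.
- by have [z /eqP[]] := complex_nonzero f; exact: same.
- by have [z /eqP[]] := complex_nonzero g; rewrite -[LHS]same.
(* Ends with the same component for every finite set have equivalent rays, so they are equal as
   classes. *)
have [S Sfin Sab] : exists2 S, finite_set S & end_component S a <> end_component S b.
  apply: contrapT => nS.
  have {}nS S : finite_set S -> end_component S a = end_component S b.
    by move=> Sfin; apply: contrapT => ?; apply: nS; exists S.
  case/eqP: pq; congr EndPoint.
  have equiv r r' : sval a r -> sval b r' -> ray_equiv H r r'.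
    move=> ar br' S Sfin; exists (end_component S a).
    have [SC ra] := end_componentP a Sfin; have [_ rb] := end_componentP b Sfin.
    by split=> //; [exact: ra|rewrite nS //; exact: rb].
  have trans r r' r'' : ray_equiv H r r' -> ray_equiv H r' r'' -> ray_equiv H r r''.
    move=> e e' S Sfin; have [C [SC rC rC']] := e _ Sfin; have [D [SD rD rD']] := e' _ Sfin.
    have [x [Cx Dx]] := tail_in_meet rC' rD; exists C; split=> //.
    by rewrite (component_eq SC SD Cx Dx).
  have sym r r' : ray_equiv H r r' -> ray_equiv H r' r.
    by move=> e S /e[C [SC rC rC']]; exists C.
  have refl r : ray H r -> ray_equiv H r r.
    by move=> hr S Sfin; have [C SC rC] := ray_component hr Sfin; exists C.
  case: a b {same nS} equiv => a [r hr aE] [b [r' hr' bE]] /= equiv.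
  apply: eq_exist; move: (equiv r r'); rewrite aE bE /= => /(_ _ _)rr'.
  have {}rr' : ray_equiv H r r' by apply: rr'; split=> //; exact: refl.
  apply/seteqP; split=> w [hw ew]; split=> //.
    exact: trans (sym _ _ rr') ew.
  exact: trans rr' ew.
exists (end_nbhd S a, end_nbhd S b); rewrite /= ?inE //.
split; [exact: end_nbhd_open|exact: end_nbhd_open|].
apply/seteqP; split=> // -[f|c]; last first.
  by move=> [/= -> ?]; apply: Sab.
move=> [/(end_nbhd_complexP _ _ Sfin)[z az fz] /(end_nbhd_complexP _ _ Sfin)[w bw fw]].
have [Sa _] := end_componentP a Sfin; have [Sb _] := end_componentP b Sfin.
apply: Sab; have [zw|zw] := complex_adj fz fw.
  by apply: (component_eq Sa Sb az); rewrite zw.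
apply: (component_eq Sa Sb (x := w)) => //.
exact: (component_step Sa az zw (component_disj Sb bw)).
Qed.

(* Off the complex, that is, for [u], [v] not adjacent or [s] outside the unit
   interval, this is the junk value [vertex_point u]. *)
Definition edge_point u v s : freudenthal R H :=
  if pselect (in_complex H setT (segment u v s)) is left h
  then ComplexPoint (exist _ _ h) else vertex_point R H u.

Lemma edge_pointE u v s : H u v -> 0 <= s <= 1 ->
  exists2 f : complex R H, edge_point u v s = ComplexPoint f & sval f = segment u v s.
Proof.
move=> uv s01; rewrite /edge_point; case: pselect => [h|[]].
  by exists (exist _ _ h).
by right; exists u, v, s.
Qed.

Lemma weight_edge_point u v s z : H u v -> 0 <= s <= 1 ->
  weight z (edge_point u v s) = if z == u then 1 - s else if z == v then s else 0.
Proof.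
move=> uv s01; have [f -> /= ->] := edge_pointE uv s01.
by rewrite segmentE ?(adj_neq uv).
Qed.

Lemma edge_point0 u v : H u v -> edge_point u v 0 = vertex_point R H u.
Proof.
move=> uv; have [|f -> fE] := edge_pointE uv (s := 0); first by lra.
by congr ComplexPoint; apply: complex_eq; rewrite fE segment0.
Qed.

Lemma edge_point1 u v : H u v -> edge_point u v 1 = vertex_point R H v.
Proof.
move=> uv; have [|f -> fE] := edge_pointE uv (s := 1); first by lra.
by congr ComplexPoint; apply: complex_eq; rewrite fE segment_sym subrr segment0.
Qed.

(** Continuity relative to the unit interval, in terms of distances so that rescaling the time is
    linear arithmetic. *)
Definition unit_continuous_at (F : R -> freudenthal R H) t : Prop :=
  forall U, open U -> U (F t) -> exists2 e, 0 < e &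
    forall t', 0 <= t' <= 1 -> `|t' - t| < e -> U (F t').

Lemma edge_point_continuous u v t : H u v -> 0 <= t <= 1 ->
  unit_continuous_at (edge_point u v) t.
Proof.
move=> uv t01 U Uo Ut; have [/(_ _ _ uv) + _] := Uo.
move=> /open_subspaceP[W Wo WU].
have tr s : 0 <= s <= 1 -> edge_trace u v U s <-> U (edge_point u v s).
  move=> s01; have [f -> fE] := edge_pointE uv s01; split.
    by move=> [g Ug gE]; rewrite (_ : f = g) //; apply: complex_eq; rewrite fE.
  by move=> Uf; exists f.
have Wt : W t.
  have : (edge_trace u v U `&` `[0, 1]%classic) t by split; [apply/tr|rewrite /= in_itv].
  by rewrite -WU => -[].
have /nbhs_ballP[e /= e0 eW] : nbhs t W by exact: open_nbhs_nbhs.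
exists e => // t' t'01 tt'; apply/tr => //.
have : (W `&` `[0, 1]%classic) t'.
  by split; [apply: eW; rewrite /ball /= distrC|rewrite /= in_itv].
by rewrite WU => -[].
Qed.

(** For a set [A] with finite boundary this is the closure of the subgraph induced by [A]. *)
Definition in_region A p : Prop :=
  match p with
  | ComplexPoint f => forall z, sval f z != 0 -> A z
  | EndPoint a => forall r, sval a r -> tail_in r A
  end.

Lemma in_region_sub A B p : A `<=` B -> in_region A p -> in_region B p.
Proof.
move=> AB; case: p => [f|a] /= h; first by move=> z /h/AB.
by move=> r /h[n hn]; exists n => k /hn/AB.
Qed.

Lemma in_region_disj A B p : in_region A p -> in_region B p -> exists z, A z /\ B z.
Proof.
case: p => [f|a] /= hA hB; last first.
  have [r ar] := graph_end_inhabited a; exact: tail_in_meet (hA _ ar) (hB _ ar).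
by have [z fz] := complex_nonzero f; exists z; split; [exact: hA|exact: hB].
Qed.

Lemma in_region_weight A p z : in_region A p -> weight z p != 0 -> A z.
Proof. by case: p => [f|a] /=; [move=> h /h|rewrite eqxx]. Qed.

Lemma in_region_edge A u v s : H u v -> 0 <= s <= 1 -> A u -> A v ->
  in_region A (edge_point u v s).
Proof.
move=> uv s01 Au Av; have [f -> fE] := edge_pointE uv s01.
move=> z; rewrite fE segmentE ?(adj_neq uv) //.
by case: (eqVneq z u) => [->//|_]; case: (eqVneq z v) => [->//|_]; rewrite eqxx.
Qed.

(** A common point of the complex is supported on [v] alone; a common end would have a ray that is
    eventually constant. *)
Lemma in_region_singleton A B p v : in_region A p -> in_region B p ->
  A `&` B `<=` [set v] -> p = vertex_point R H v.
Proof.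
move=> pA pB ABv; case: p pA pB => [f|a] /= pA pB; last first.
  have [r ar] := graph_end_inhabited a.
  have [rinj _] : ray H r by case: a ar {pA pB} => a /= [r' _ ->] [].
  have [n nA] := pA r ar; have [k kB] := pB r ar.
  have rv i : (maxn n k <= i)%N -> r i = v.
    by rewrite geq_max => /andP[ni ki]; apply: ABv; split; [exact: nA|exact: kB].
  have : r (maxn n k) = r (maxn n k).+1 by rewrite !rv.
  by move=> /rinj /eqP; rewrite -[X in _ == X]addn1 -[X in X == _]addn0 eqn_add2l.
have fv z : sval f z != 0 -> z = v by move=> fz; apply: ABv; split; [exact: pA|exact: pB].
congr ComplexPoint; apply: complex_eq => /=.
case: f {pA pB} fv => f /= [[x _ ->]|[x [y [t [_ _ xy t01 ->]]]]] fv.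
  by rewrite -(fv x) // /vertex_coord eqxx oner_eq0.
have nxy := adj_neq xy.
have [t0|t0] := eqVneq t 0.
  rewrite t0 segment0 -(fv x) // segmentE // eqxx t0 subr0.
  by rewrite oner_eq0.
have yv : y = v by apply: fv; rewrite segmentE // [y == x]eq_sym (negbTE nxy) eqxx.
have [t1|t1] := eqVneq t 1; first by rewrite t1 segment_sym subrr segment0 yv.
have xv : x = v by apply: fv; rewrite segmentE // eqxx subr_eq0 eq_sym.
by rewrite xv yv eqxx in nxy.
Qed.

End Space.

(** * Traversing a region *)

(** A descent and its continuation one level down use different defaults but must choose the same
    limit point. *)
Lemma xget_default (X : choiceType) (d d' : X) (P : set X) :
  P !=set0 -> xget d P = xget d' P.
Proof.
move=> [q Pq]; rewrite /xget; case: pselect => // -[]; exists q; exact/asboolP.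
Qed.

Section Traversal.
Local Open Scope ring_scope.
Context (R : realType) {V : choiceType} (H : graph V) (T : arc_tree H).
Implicit Types (p q : freudenthal R H) (u v z a b : V) (s t : R) (A : set V).
Implicit Types (e f : node T) (L : seq (node T)).
Local Notation vertex := (vertex_point R H).
Local Notation edge := (@edge_point R V H).

(** Pasting along three closed thirds. A third not containing [t] only requires a radius below its
    distance from [t]. *)
Lemma unit_continuous_thirds (F F1 F2 F3 : R -> freudenthal R H) t :
  (forall s, 0 <= s -> 3 * s <= 1 -> F s = F1 (3 * s)) ->
  (forall s, 1 <= 3 * s -> 3 * s <= 2 -> F s = F2 (3 * s - 1)) ->
  (forall s, 2 <= 3 * s -> s <= 1 -> F s = F3 (3 * s - 2)) ->
  0 <= t <= 1 ->
  (3 * t <= 1 -> unit_continuous_at F1 (3 * t)) ->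
  (1 <= 3 * t -> 3 * t <= 2 -> unit_continuous_at F2 (3 * t - 1)) ->
  (2 <= 3 * t -> unit_continuous_at F3 (3 * t - 2)) ->
  unit_continuous_at F t.
Proof.
move=> E1 E2 E3 t01 C1 C2 C3 U Uo Ut.
have [e1 e1_gt0 P1] : exists2 e, 0 < e &
    forall t', 0 <= t' -> 3 * t' <= 1 -> `|t' - t| < e -> U (F t').
  have [t1|t1] := lerP (3 * t) 1; last first.
    by exists (t - 1 / 3) => [|t' t'0 t'1]; [lra|rewrite ltr_norml; lra].
  have [|e e0 eU] := C1 t1 U Uo; first by rewrite -E1 //; lra.
  exists (e / 3) => [|t' t'0 t'1]; first by lra.
  rewrite ltr_norml => tt'; rewrite E1 //; apply: eU; first by lra.
  by rewrite ltr_norml; lra.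
have [e2 e2_gt0 P2] : exists2 e, 0 < e &
    forall t', 1 <= 3 * t' -> 3 * t' <= 2 -> `|t' - t| < e -> U (F t').
  have [t1|t1] := ltrP (3 * t) 1.
    by exists (1 / 3 - t) => [|t' t'0 t'1]; [lra|rewrite ltr_norml; lra].
  have [t2|t2] := lerP (3 * t) 2; last first.
    by exists (t - 2 / 3) => [|t' t'0 t'1]; [lra|rewrite ltr_norml; lra].
  have [|e e0 eU] := C2 t1 t2 U Uo; first by rewrite -E2.
  exists (e / 3) => [|t' t'0 t'1]; first by lra.
  rewrite ltr_norml => tt'; rewrite E2 //; apply: eU; first by lra.
  by rewrite ltr_norml; lra.
have [e3 e3_gt0 P3] : exists2 e, 0 < e &
    forall t', 2 <= 3 * t' -> t' <= 1 -> `|t' - t| < e -> U (F t').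
  have [t2|t2] := ltrP (3 * t) 2.
    by exists (2 / 3 - t) => [|t' t'0 t'1]; [lra|rewrite ltr_norml; lra].
  have [|e e0 eU] := C3 t2 U Uo; first by rewrite -E3 //; lra.
  exists (e / 3) => [|t' t'0 t'1]; first by lra.
  rewrite ltr_norml => tt'; rewrite E3 //; apply: eU; first by lra.
  by rewrite ltr_norml; lra.
exists (Num.min e1 (Num.min e2 e3)); first by rewrite !lt_min e1_gt0 e2_gt0.
move=> t' t'01; rewrite !lt_min => /and3P[d1 d2 d3].
have [t1|t1] := lerP (3 * t') 1; first by apply: P1 => //; lra.
have [t2|t2] := lerP (3 * t') 2; first by apply: P2 => //; lra.
by apply: P3 => //; lra.
Qed.

(* An arc from [a] to [b] through the kids [L] spends the first third of its
   time on the edge from [a] to the first kid [f], the second on [f], and the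
   last on the rest of the arc. *)
Fixpoint locate a L b t : (V * V * R) + (node T * R) :=
  if L is f :: L' then
    if 3 * t <= 1 then inl (a, src f, 3 * t)
    else if 3 * t <= 2 then inr (f, 3 * t - 1)
    else locate (tgt f) L' b (3 * t - 2)
  else inl (a, b, t).

Definition descend (x : node T * R) : (V * V * R) + (node T * R) :=
  locate (src x.1) (kids x.1) (tgt x.1) x.2.

Fixpoint run n (x : node T * R) : (V * V * R) + (node T * R) :=
  if n is n'.+1 then
    match descend x with inl y => inl y | inr x' => run n' x' end
  else inr x.

Lemma runS n x : run n.+1 x =
  match run n x with inl y => inl y | inr x' => descend x' end.
Proof.
elim: n x => [|n IH] x /=; first by case: (descend x).
by case: (descend x) => // x'; exact: IH.
Qed.

Definition halts x y := exists n, run n x = inl y.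

Lemma halts_unique x y y' : halts x y -> halts x y' -> y = y'.
Proof.
have later i j w : (i <= j)%N -> run i x = inl w -> run j x = inl w.
  move=> /subnKC <- E; elim: (j - i)%N => [|d IH]; rewrite ?addn0 ?addnS //.
  by rewrite runS IH.
move=> [n ny] [n' ny'].
have := later _ _ _ (leq_maxl n n') ny.
by rewrite (later _ _ _ (leq_maxr n n') ny') => -[].
Qed.

Lemma halts_descend x x' y : descend x = inr x' -> halts x y <-> halts x' y.
Proof.
move=> xx'; split=> [[[|n]]|[n ny]] //=; last by exists n.+1; rewrite /= xx'.
by rewrite xx' => ny; exists n.
Qed.

Definition limit_points x : set (freudenthal R H) :=
  [set q | forall n x', run n x = inr x' -> in_region (region x'.1) q].

Definition edge_of (y : V * V * R) := edge y.1.1 y.1.2 y.2.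

(** When no edge is reached, [limit_points_ex] supplies a limit point, so the default of [xget] is
    never taken. *)
Definition traverse_state (x : node T * R) : freudenthal R H :=
  match pselect (exists y, halts x y) with
  | left h => edge_of (projT1 (cid h))
  | right _ => xget (vertex (src x.1)) (limit_points x)
  end.

Definition traverse e t := traverse_state (e, t).

Definition arc a L b t : freudenthal R H :=
  match locate a L b t with inl y => edge_of y | inr x => traverse_state x end.

Lemma locate_kid a L b t f s : locate a L b t = inr (f, s) -> f \in L.
Proof.
elim: L a t => //= g L IH a t; case: ifP => // _; case: ifP => _.
  by move=> [-> _]; rewrite mem_head.
by move=> /IH fL; rewrite inE fL orbT.
Qed.

(** Breakpoints go to the earlier piece, so a kid can be located at time 1 but never at time 0. *)
Lemma locate_time a L b t f s : t <= 1 ->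
  locate a L b t = inr (f, s) -> 0 < s <= 1.
Proof.
elim: L a t => //= g L IH a t t1; case: (lerP (3 * t) 1) => // h.
  case: (lerP (3 * t) 2) => h'.
  by move=> [_ <-]; lra.
by apply: IH; lra.
Qed.

Lemma locate0 a L b : exists y, locate a L b 0 = inl y.
Proof.
case: L => [|f L] /=; first by exists (a, b, 0).
by rewrite mulr0 ler01; exists (a, src f, 0).
Qed.

Lemma locate1 a L b : exists y, locate a L b 1 = inl y.
Proof.
elim: L a => [|f L IH] a /=; first by exists (a, b, 1).
case: lerP => h; first by exfalso; lra.
case: lerP => h'; first by exfalso; lra.
by rewrite (_ : 3 * 1 - 2 = 1 :> R) //; lra.
Qed.

(** Remove the finite boundary of the region: a component that meets the region cannot leave it. *)
Lemma region_tail_equiv e (r r' : nat -> V) : tail_in r (region e) ->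
  ray_equiv H r r' -> tail_in r' (region e).
Proof.
move=> re /(_ _ (region_boundary e))[C [[c cB CE] rC [n r'C]]].
have [x [xe xC]] := tail_in_meet re rC.
exists n => k /r'C; rewrite CE in xC *; move=> /= cy.
have [p [xp <- pB]] := joined_trans (joined_sym xC) cy.
elim: p x xe {xC} xp pB => //= y p IH x xe /andP[xy yp] pB.
apply: IH => //; last by move=> z zp; apply: pB; rewrite inE zp orbT.
apply: contrapT => ye; apply: (pB x); first exact: mem_head.
by split=> //; exists y.
Qed.

(** * Descents that never reach an edge *)

Section Descent.
Variable x : node T * R.
Hypothesis x_runs : ~ exists y, halts x y.

Lemma run_inr n : exists x', run n x = inr x'.
Proof.
case E: (run n x) => [y|x']; last by exists x'.
by case: x_runs; exists y, n.
Qed.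

Definition nth_node n := (projT1 (cid (run_inr n))).1.

Lemma nth_nodeE n x' : run n x = inr x' -> nth_node n = x'.1.
Proof.
by rewrite /nth_node; case: cid => x'' /= -> [->].
Qed.

Lemma nth_node_kid n : nth_node n.+1 \in kids (nth_node n).
Proof.
have [x' E] := run_inr n; have [[f s] E'] := run_inr n.+1.
rewrite (nth_nodeE E) (nth_nodeE E') /=; move: E'; rewrite runS E.
exact: locate_kid.
Qed.

Lemma nth_node_region n k : (n <= k)%N ->
  region (nth_node k) `<=` region (nth_node n).
Proof.
move=> /subnKC <-; elim: (k - n)%N => [|d IH]; first by rewrite addn0.
rewrite addnS; apply: (subset_trans _ IH).
by have [] := region_kid (nth_node_kid (n + d)).
Qed.

Definition descent_ray n := src (nth_node n).

(** Starts of successive nodes are adjacent, and they are distinct because the region of a kid omits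
    the start of its parent. *)
Lemma descent_rayP : ray H descent_ray.
Proof.
have lt i j : (i < j)%N -> descent_ray i <> descent_ray j.
  move=> ij rij; have [_ + _] := region_kid (nth_node_kid i); apply.
  rewrite -/(descent_ray i) rij; apply: (nth_node_region ij).
  exact: region_src.
split=> [i j ij|n]; last exact: src_adj_kid (nth_node_kid n).
by case: (ltngtP i j) => // /lt h; [case: h|case: h; rewrite ij].
Qed.

(** The end of the descent ray belongs to every region of the descent, by [region_tail_equiv]. *)
Lemma limit_points_ex : limit_points x !=set0.
Proof.
pose r := descent_ray.
have aP : is_end H [set r' | ray H r' /\ ray_equiv H r r'].
  by exists r => //; exact: descent_rayP.
exists (EndPoint R (exist _ _ aP)) => n x' E r' /= [_ rr'].
apply: region_tail_equiv rr'; exists n => k nk.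
by rewrite -(nth_nodeE E); apply: (nth_node_region nk); exact: region_src.
Qed.

(* Every vertex is [src] or [tgt] of a node at finite depth, so a descent
   leaves every finite set. *)
Lemma nth_node_leaves z : exists n, forall k, (n <= k)%N ->
  ~ region (nth_node k) z.
Proof.
have [z0|z0] := pselect (region (nth_node 0) z); last first.
  by exists 0%N => k _ /(nth_node_region (leq0n k)).
have [d] := region_visits z0; move: {z0} 0%N => i.
suff h : visits (@src _ _ T) (@tgt _ _ T) (@kids _ _ T) d (nth_node i) z ->
    exists n, ~ region (nth_node n) z.
  move=> /h[n nz]; exists n => k nk /(nth_node_region nk); exact: nz.
elim: d i => [|d IH] i vz.
  exists i.+1; have [_ ns nt] := region_kid (nth_node_kid i).
  by case: vz => // ->.
case: vz => [->|->|[f fi fz]].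
- by exists i.+1; have [] := region_kid (nth_node_kid i).
- by exists i.+1; have [] := region_kid (nth_node_kid i).
have [fE|fE] := eqVneq f (nth_node i.+1); first by apply: (IH i.+1); rewrite -fE.
have fz' : region f z.
  elim: (d) (f) fz => [|n IHn] g /=; first by case=> // ->; [exact: region_src|exact: region_tgt].
  case=> [->|->|[h hg hz]]; [exact: region_src|exact: region_tgt|].
  by have [+ _ _] := region_kid hg; apply; exact: IHn.
exists i.+1 => nz; have := kids_disjoint fi (nth_node_kid i) fE.
by move=> /seteqP[/(_ z)] h _; exact: h.
Qed.

Lemma nth_node_avoids (S : set V) : finite_set S ->
  exists n, region (nth_node n) `&` S = set0.
Proof.
move=> /finite_seqP[s ->].
suff [n ns] : exists n, forall z, z \in s -> ~ region (nth_node n) z.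
  by exists n; apply/seteqP; split=> // z [nz /ns].
elim: s => [|z s [n ns]]; first by exists 0%N.
have [k kz] := nth_node_leaves z; exists (maxn k n) => w.
rewrite inE => /orP[/eqP ->|/ns nw]; first by apply: kz; exact: leq_maxl.
by move=> /(nth_node_region (leq_maxr k n)).
Qed.

End Descent.

Lemma traverse_state_halts x y : halts x y -> traverse_state x = edge_of y.
Proof.
move=> xy; rewrite /traverse_state; case: pselect => [h|[]]; last by exists y.
by case: cid => y' /= xy'; rewrite (halts_unique xy' xy).
Qed.

(** The self-similarity of the traversal. For limit points it holds because the regions are nested,
    so dropping the outermost one changes nothing. *)
Lemma traverse_stateE x : traverse_state x =
  match descend x with inl y => edge_of y | inr x' => traverse_state x' end.
Proof.
case E: (descend x) => [y|x'].
  by apply: traverse_state_halts; exists 1%N; rewrite /= E.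
have [[y xy]|x_runs] := pselect (exists y, halts x y).
  rewrite (traverse_state_halts xy) (@traverse_state_halts x' y) //.
  exact/(halts_descend y E).
have x'_runs : ~ exists y, halts x' y.
  by move=> [y /(halts_descend y E) xy]; apply: x_runs; exists y.
rewrite /traverse_state; case: pselect => // _; case: pselect => // _.
rewrite (_ : limit_points x = limit_points x').
  by apply: xget_default; exact: limit_points_ex.
apply/seteqP; split=> q qx n x'' nx''; first by apply: (qx n.+1); rewrite /= E.
case: n nx'' => [[<-]|n /=]; last by rewrite E; exact: qx.
move: (qx 0%N _ erefl); apply: in_region_sub.
by case: x' E {x'_runs qx} => f s /locate_kid /region_kid[].
Qed.

Lemma traverse_arc e t : traverse e t = arc (src e) (kids e) (tgt e) t.
Proof. by rewrite /traverse traverse_stateE. Qed.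

Local Notation linkedT := (linked H (@src _ _ T) (@tgt _ _ T)).

(** An invariant of arcs that passes to the rest of the arc after its first kid ([simple_cons]), as
    inductions on [L] need. *)
Record simple_arc a L b : Prop := SimpleArc {
  simple_linked : linkedT a L b;
  simple_neq : a != b;
  simple_out : forall f, f \in L -> ~ region f a /\ ~ region f b;
  simple_uniq : uniq L;
  simple_disjoint : forall f g, f \in L -> g \in L -> f != g ->
    region f `&` region g = set0 }.

Lemma simple_kids e : simple_arc (src e) (kids e) (tgt e).
Proof.
split.
- exact: kids_linked.
- exact: adj_neq (src_adj_tgt e).
- by move=> f /region_kid[].
- exact: kids_uniq.
- exact: kids_disjoint.
Qed.

Lemma simple_cons a f L b : simple_arc a (f :: L) b ->
  [/\ H a (src f), simple_arc (tgt f) L b,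
      forall g, g \in L -> region f `&` region g = set0,
      ~ region f a /\ ~ region f b & a != b].
Proof.
case=> -[afH fL] ab out /= /andP[fNL Lu] disj.
have fl : f \in f :: L by rewrite mem_head.
have gl g : g \in L -> g \in f :: L by move=> gL; rewrite inE gL orbT.
have fdisj g : g \in L -> region f `&` region g = set0.
  by move=> gL; apply: disj => //; [exact: gl|apply: contraNneq fNL => ->].
have [fa fb] := out f fl.
split=> //; split=> //.
- by apply/eqP => fE; apply: fb; rewrite -fE; exact: region_tgt.
- move=> g gL; have [_ gb] := out g (gl _ gL); split=> // gf.
  by move/seteqP: (fdisj _ gL) => [/(_ (tgt f)) h _]; apply: h; split=> //; exact: region_tgt.
- by move=> g h gL hL; apply: disj; exact: gl.
Qed.

Lemma arc0 a L b : linkedT a L b -> arc a L b 0 = vertex a.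
Proof.
case: L => [|f L] /=; first exact: edge_point0.
by move=> [af _]; rewrite /arc /= mulr0 ler01; exact: edge_point0.
Qed.

Lemma arc1 a L b : linkedT a L b -> arc a L b 1 = vertex b.
Proof.
elim: L a => [|f L IH] a /=; first exact: edge_point1.
move=> [_ /IH <-]; rewrite /arc /=.
case: (lerP (3 * 1) 1) => h; first by exfalso; lra.
case: (lerP (3 * 1) 2) => h'; first by exfalso; lra.
by rewrite (_ : 3 * 1 - 2 = 1 :> R) //; lra.
Qed.

Lemma traverse0 e : traverse e 0 = vertex (src e).
Proof. by rewrite traverse_arc arc0 //; exact: kids_linked. Qed.

Lemma traverse1 e : traverse e 1 = vertex (tgt e).
Proof. by rewrite traverse_arc arc1 //; exact: kids_linked. Qed.

Lemma arc_nil a b t : arc a [::] b t = edge a b t. Proof. by []. Qed.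

Lemma arc_first a f L b t : 3 * t <= 1 -> arc a (f :: L) b t = edge a (src f) (3 * t).
Proof. by rewrite /arc /= => ->. Qed.

(** Valid on the closed third: at the breakpoint, which [locate] assigns to the edge, both pieces
    are at [src f]. *)
Lemma arc_second a f L b t : H a (src f) -> 1 <= 3 * t -> 3 * t <= 2 ->
  arc a (f :: L) b t = traverse f (3 * t - 1).
Proof.
move=> af t1 t2; rewrite /arc /= t2; case: lerP => // t1'.
have -> : 3 * t = 1 by lra.
by rewrite subrr traverse0 /edge_of /= edge_point1.
Qed.

Lemma arc_third a f L b t : linkedT a (f :: L) b -> 2 <= 3 * t ->
  arc a (f :: L) b t = arc (tgt f) L b (3 * t - 2).
Proof.
move=> [af fL] t2; rewrite {1}/arc /=.
case: (lerP (3 * t) 1) => h; first by exfalso; lra.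
case: (lerP (3 * t) 2) => // h'.
have -> : 3 * t = 2 by lra.
rewrite subrr arc0 //.
by rewrite (_ : 2 - 1 = 1 :> R) ?[traverse_state _]traverse1 //; lra.
Qed.

Definition arc_region a L b : set V :=
  [set z | [\/ z = a, z = b | exists2 f, f \in L & region f z]].

(** The claim on the located kid is a hypothesis, to be supplied in [traverse_in_region] by
    induction on the number of steps to halting. *)
Lemma arc_in_region_locate a L b t : linkedT a L b -> 0 <= t <= 1 ->
  (forall f s, locate a L b t = inr (f, s) -> in_region (region f) (traverse f s)) ->
  in_region (arc_region a L b) (arc a L b t).
Proof.
rewrite /arc; elim: L a t => [|f L IH] a t /=.
  by move=> ab t01 _; apply: in_region_edge => //; [constructor 1|constructor 2].
move=> [af fL] t01; case: (lerP (3 * t) 1) => t1.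
  move=> _; apply: in_region_edge => //; first by move=> /=; lra.
    by constructor 1.
  by constructor 3; exists f; [rewrite mem_head|exact: region_src].
case: (lerP (3 * t) 2) => t2.
  move=> /(_ _ _ erefl); apply: in_region_sub => z fz.
  by constructor 3; exists f; rewrite ?mem_head.
move=> h; have := IH _ (3 * t - 2) fL _ h; move=> /(_ _) hh.
apply: in_region_sub (hh _); last by lra.
move=> z [->|->|[g gL gz]]; [|by constructor 2|].
  by constructor 3; exists f; [rewrite mem_head|exact: region_tgt].
by constructor 3; exists g; rewrite // inE gL orbT.
Qed.

Lemma arc_region_kids e : arc_region (src e) (kids e) (tgt e) `<=` region e.
Proof.
move=> z [->|->|[f fe fz]]; [exact: region_src|exact: region_tgt|].
by have [+ _ _] := region_kid fe; apply.
Qed.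

Lemma traverse_in_region e t : 0 <= t <= 1 -> in_region (region e) (traverse e t).
Proof.
move=> t01; have [[y [n]]|h] := pselect (exists y, halts (e, t) y); last first.
  rewrite /traverse /traverse_state; case: pselect => // _ /=.
  have /(xgetPex (vertex (src e))) := limit_points_ex h.
  by move=> /(_ 0%N _ erefl).
elim: n e t t01 => //= n IH e t t01 ny; rewrite traverse_arc.
apply: in_region_sub (@arc_region_kids e) _; apply: arc_in_region_locate => //.
  exact: kids_linked.
move=> f s E; apply: IH; last by move: ny; rewrite /descend /= E.
have : 0 < s <= 1 by apply: (locate_time _ E); lra.
by lra.
Qed.

Lemma arc_in_region a L b t : linkedT a L b -> 0 <= t <= 1 ->
  in_region (arc_region a L b) (arc a L b t).
Proof.
move=> ab t01; apply: arc_in_region_locate => // f s E.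
apply: traverse_in_region; have : 0 < s <= 1 by apply: (locate_time _ E); lra.
by lra.
Qed.

(** * Continuity of the traversal *)

Lemma arc_continuous_locate a L b t : linkedT a L b -> 0 <= t <= 1 ->
  (forall f, f \in L -> unit_continuous_at (traverse f) 0) ->
  (forall f, f \in L -> unit_continuous_at (traverse f) 1) ->
  (forall f s, locate a L b t = inr (f, s) -> unit_continuous_at (traverse f) s) ->
  unit_continuous_at (arc a L b) t.
Proof.
elim: L a t => [|f L IH] a t /= ab t01 C0 C1 Cs.
  exact: edge_point_continuous.
have [af fL] := ab; have ff : f \in f :: L by rewrite mem_head.
apply: (@unit_continuous_thirds (arc a (f :: L) b) (edge a (src f)) (traverse f) (arc (tgt f) L b)) => //.
- by move=> s _; exact: arc_first.
- by move=> s; exact: arc_second.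
- by move=> s h _; exact: arc_third.
- by move=> t1; apply: edge_point_continuous => //; lra.
(* At the breakpoint [locate] reports the edge, so continuity of [f] at its start comes from a
   separate hypothesis. *)
- move=> t1 t2; have [t1'|t1'] := lerP (3 * t) 1.
    by rewrite (_ : 3 * t - 1 = 0); [exact: C0|lra].
  by apply: Cs; rewrite leNgt t1' /= t2.
- move=> t2; apply: IH => //; first by lra.
  + by move=> g gL; apply: C0; rewrite inE gL orbT.
  + by move=> g gL; apply: C1; rewrite inE gL orbT.
  move=> g s; have [t2'|t2'] := lerP (3 * t) 2.
    rewrite (_ : 3 * t - 2 = 0); last by lra.
    by have [y ->] := locate0 (tgt f) L b.
  move=> E; apply: Cs; rewrite leNgt [_ < _](_ : _ = true) /=; last by lra.
  by rewrite leNgt t2'.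
Qed.

(** At its two ends an arc runs along an edge, so no continuity of the kids is involved. *)
Lemma arc_continuous0 a L b : linkedT a L b -> unit_continuous_at (arc a L b) 0.
Proof.
case: L => [|f L] /= ab; first by apply: edge_point_continuous => //; lra.
have [af fL] := ab.
apply: (@unit_continuous_thirds (arc a (f :: L) b) (edge a (src f)) (traverse f) (arc (tgt f) L b)); try lra.
- by move=> s _; exact: arc_first.
- by move=> s; exact: arc_second.
- by move=> s h _; exact: arc_third.
- by move=> _; apply: edge_point_continuous => //; lra.
Qed.

Lemma arc_continuous1 a L b : linkedT a L b -> unit_continuous_at (arc a L b) 1.
Proof.
elim: L a => [|f L IH] a /= ab; first by apply: edge_point_continuous => //; lra.
have [af fL] := ab.
apply: (@unit_continuous_thirds (arc a (f :: L) b) (edge a (src f)) (traverse f) (arc (tgt f) L b)); try lra.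
- by move=> s _; exact: arc_first.
- by move=> s; exact: arc_second.
- by move=> s h _; exact: arc_third.
- by rewrite (_ : 3 * 1 - 2 = 1 :> R); [move=> _; exact: IH|lra].
Qed.

Lemma traverse_continuous_descend e t : 0 <= t <= 1 ->
  (forall f s, descend (e, t) = inr (f, s) -> unit_continuous_at (traverse f) s) ->
  unit_continuous_at (traverse e) t.
Proof.
move=> t01 Cs; rewrite (_ : traverse e = arc (src e) (kids e) (tgt e)); last first.
  by apply/funext => s; exact: traverse_arc.
have trE f : traverse f = arc (src f) (kids f) (tgt f).
  by apply/funext => s; exact: traverse_arc.
apply: arc_continuous_locate => //; first exact: kids_linked.
  by move=> f _; rewrite trE; apply: arc_continuous0; exact: kids_linked.
by move=> f _; rewrite trE; apply: arc_continuous1; exact: kids_linked.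
Qed.

(** Since [s < 1], the time [t] is interior to the time interval of [f], so nearby times fall in the
    same kid. *)
Lemma arc_local a L b t f s : linkedT a L b -> 0 <= t <= 1 ->
  locate a L b t = inr (f, s) -> s < 1 ->
  forall d, 0 < d -> exists2 c, 0 < c & forall t', 0 <= t' <= 1 -> `|t' - t| < c ->
    exists s', [/\ 0 <= s' <= 1, `|s' - s| < d & arc a L b t' = traverse f s'].
Proof.
elim: L a t => //= g L IH a t ab t01; have [ag gL] := ab.
case: (lerP (3 * t) 1) => // t1; case: (lerP (3 * t) 2) => t2.
  move=> [<- <-] s1 d d0.
  exists (Num.min (d / 3) (Num.min (t - 1 / 3) (2 / 3 - t))).
    by rewrite !lt_min; apply/and3P; split; lra.
  move=> t' t'01; rewrite !lt_min !ltr_norml => /and3P[h1 h2 h3].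
  exists (3 * t' - 1); split; [lra|rewrite ltr_norml; lra|].
  by apply: arc_second => //; lra.
move=> E s1 d d0; have [|c c0 cP] := IH _ _ gL _ E s1 d d0; first by lra.
exists (Num.min (c / 3) (t - 2 / 3)); first by rewrite lt_min; apply/andP; split; lra.
move=> t' t'01; rewrite lt_min !ltr_norml => /andP[h1 h2].
have [||s' [s'01 s's E']] := cP (3 * t' - 2); [lra|rewrite ltr_norml; lra|].
by exists s'; split=> //; rewrite -E'; apply: arc_third => //; lra.
Qed.

Lemma run_halts n x x' y : run n x = inr x' -> halts x' y -> halts x y.
Proof.
elim: n x => [|n IH] x /=; first by move=> [->].
by case E: (descend x) => [//|x''] /IH h /h /(halts_descend y E).
Qed.

Lemma traverse_local e t : 0 <= t <= 1 -> ~ (exists y, halts (e, t) y) ->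
  forall n f s, run n (e, t) = inr (f, s) -> 0 <= s <= 1 /\
  forall d, 0 < d -> exists2 c, 0 < c & forall t', 0 <= t' <= 1 -> `|t' - t| < c ->
    exists s', [/\ 0 <= s' <= 1, `|s' - s| < d & traverse e t' = traverse f s'].
Proof.
move=> t01 et; elim=> [|n IH] f s.
  by move=> [<- <-]; split=> // d d0; exists d => // t' t'01 tt'; exists t'.
rewrite runS; case E: (run n (e, t)) => [//|[g r]] E'.
have [r01 gP] := IH _ _ E.
have s01 : 0 < s <= 1 by apply: (locate_time _ E'); case/andP: r01.
split=> [|d d0]; first by lra.
(* At time 1 the descent would halt in the next step. *)
have s1 : s < 1.
  rewrite lt_neqAle (andP s01).2 andbT; apply/eqP => sE.
  have [y yE] := locate1 (src f) (kids f) (tgt f).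
  apply: et; exists y; apply: (@run_halts n.+1 _ (f, s)).
    by rewrite runS E.
  by exists 1%N; rewrite /= /descend sE /= yE.
have [c c0 cP] := arc_local (kids_linked g) r01 E' s1 d0.
have [c' c'0 c'P] := gP _ c0.
exists c' => // t' t'01 /(c'P _ t'01)[r' [r'01 rr' ->]].
by have [s' [s'01 ss' E'']] := cP _ r'01 rr'; exists s'; split=> //; rewrite traverse_arc.
Qed.

(** The descent leaves every finite set [S], so some region on it avoids [S]; being connected, it
    lies in the component of the limit end. All nearby times are traversed within that region. *)
Lemma limit_point_continuous e t : 0 <= t <= 1 -> ~ (exists y, halts (e, t) y) ->
  unit_continuous_at (traverse e) t.
Proof.
move=> t01 et U Uo.
have : limit_points (e, t) (traverse e t).
  rewrite /traverse /traverse_state; case: pselect => // _.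
  exact: xgetPex (limit_points_ex et).
have nodeP n : exists s, run n (e, t) = inr (nth_node et n, s).
  by have [[f s] E] := run_inr et n; exists s; rewrite (nth_nodeE et E).
(* The limit is not in the complex: the descent would have to keep a vertex of its support. *)
case: (traverse e t) => [f|a] lim Ua.
  have [z fz] := complex_nonzero f; have [n nz] := nth_node_leaves et z.
  have [s ns] := nodeP n; case: (nz n (leqnn n)).
  exact: (lim n _ ns z fz).
have [_ /(_ _ Ua)[S Sfin SU]] := Uo.
have [n nS] := nth_node_avoids et Sfin; have [s ns] := nodeP n.
set D := region (nth_node et n) in nS.
have DC : D `<=` end_component S a.
  move=> z Dz; have [r ar] := graph_end_inhabited a.
  have [[c cS CE] rC] := end_componentP a Sfin.
  have [w [Cw Dw]] := tail_in_meet (rC _ ar) (lim n _ ns r ar).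
  rewrite CE in Cw *; apply: (joined_trans Cw).
  apply: joined_sub (region_joined Dw Dz) => u Du Su.
  by move/seteqP: nS => [/(_ u) h _]; apply: h.
have [s01 loc] := traverse_local t01 et ns.
have [c c0 cP] := loc 1 ltr01; exists c => // t' t'01 /(cP _ t'01)[s' [s'01 _ ->]].
apply: SU; have := traverse_in_region (nth_node et n) s'01.
have [SC _] := end_componentP a Sfin.
case: (traverse _ s') => [g|b] gD.
  apply/(end_nbhd_complexP _ _ Sfin); have [z gz] := complex_nonzero g.
  by exists z => //; apply: DC; exact: gD.
have [r br] := graph_end_inhabited b; have [k kD] := gD r br.
by apply/esym; apply: end_component_unique br _ => //; exists k => i /kD/DC.
Qed.

Lemma traverse_continuous e t : 0 <= t <= 1 -> unit_continuous_at (traverse e) t.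
Proof.
move=> t01; have [[y [n]]|] := pselect (exists y, halts (e, t) y); last first.
  exact: limit_point_continuous.
elim: n e t t01 => //= n IH e t t01 ny.
apply: traverse_continuous_descend => // f s E; rewrite E in ny; apply: IH => //.
have : 0 < s <= 1 by apply: (locate_time _ E); case/andP: t01.
by lra.
Qed.

(** * Injectivity of the traversal *)

Lemma arc_eq_start a L b t : simple_arc a L b -> 0 <= t <= 1 ->
  arc a L b t = vertex a -> t = 0.
Proof.
move=> abL t01 E; have /= ca := congr1 (weight a) E.
rewrite /vertex_coord eqxx /= in ca.
have one_region A p : in_region A p -> p = vertex a -> A a.
  by move=> pA pE; apply: (in_region_weight pA); rewrite pE /= /vertex_coord eqxx oner_eq0.
case: L abL E ca => [|f L] abL E.
  have := simple_linked abL => /= ab.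
  by rewrite arc_nil weight_edge_point // eqxx => ca; lra.
have [af fL fdisj [fa fb] ab] := simple_cons abL.
have [t1|t1] := lerP (3 * t) 1.
  by rewrite arc_first // weight_edge_point ?eqxx // => [ca|]; lra.
have [t2|t2] := lerP (3 * t) 2.
  move=> _; case: fa; rewrite arc_second ?(ltW t1) // in E.
  by apply: one_region E; apply: traverse_in_region; lra.
move=> _; rewrite arc_third ?(ltW t2) // in E; last exact: simple_linked abL.
have : in_region (arc_region (tgt f) L b) (arc (tgt f) L b (3 * t - 2)).
  by apply: arc_in_region; [exact: simple_linked fL|lra].
move=> /one_region/(_ E)[aE|/eqP|[g gL ga]].
- by case: fa; rewrite aE; exact: region_tgt.
- by rewrite (negbTE ab).
- by have [] := simple_out abL (f := g); rewrite ?inE ?gL ?orbT.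
Qed.

Lemma edge_point_inj u v s s' : H u v -> 0 <= s <= 1 -> 0 <= s' <= 1 ->
  edge u v s = edge u v s' -> s = s'.
Proof.
move=> uv s01 s'01 /(congr1 (weight u)).
by rewrite !weight_edge_point // eqxx => h; lra.
Qed.

(* Two times falling in the same third of an arc are pulled apart by a factor
   of 3 on descending to that third, so after finitely many steps they are
   separated. *)
Lemma arc_lt_neq n a L b t t' : simple_arc a L b -> 0 <= t -> t < t' -> t' <= 1 ->
  1 < 3 ^+ n * (t' - t) -> arc a L b t <> arc a L b t'.
Proof.
elim: n a L b t t' => [|n IH] a [|f L] b t t' abL t0 tt' t'1.
1,2: by rewrite expr0 => h; exfalso; lra.
  move=> _; have /= ab := simple_linked abL; rewrite !arc_nil => /edge_point_inj.
  by move=> /(_ ab) E; have := E _ _; lra.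
rewrite exprS -mulrA mulrCA; set d := 3 * (t' - t) => h.
have dE : 3 * t' - 3 * t = d by rewrite -mulrBr.
clearbody d.
have [af fL fdisj [fa fb] ab] := simple_cons abL.
have lk := simple_linked abL; have lk' := simple_linked fL.
have t01 : 0 <= t <= 1 by lra.
have t'01 : 0 <= t' <= 1 by lra.
have [t1|t1] := lerP (3 * t) 1.
  rewrite (arc_first _ _ _ _ t1) => E.
  have [t'1'|t'1'] := lerP (3 * t') 1.
    rewrite arc_first // in E; have /= := edge_point_inj af _ _ E.
    by move=> /(_ _ _) E'; have := E' _ _; lra.
  have [t'2|t'2] := lerP (3 * t') 2.
    rewrite (arc_second _ _ af (ltW t'1')) // in E.
    (* If [t] is the breakpoint it counts as time 0 of [f], and both times lie in the second
       third. *)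
    have [t1'|t1'] := eqVneq (3 * t) 1.
      have E' : traverse f 0 = traverse f (3 * t' - 1).
        by rewrite -E t1' edge_point1 // traverse0.
      move: E'; rewrite !traverse_arc; apply: IH; [exact: simple_kids|lra|lra|lra|].
      by rewrite (_ : 3 * t' - 1 - 0 = d) // -dE; lra.
    have := traverse_in_region f (t := 3 * t' - 1); rewrite -E => fr.
    case: fa; apply: (in_region_weight (fr _)); first by lra.
    by rewrite weight_edge_point // ?eqxx ?subr_eq0 1?eq_sym //; lra.
  rewrite (arc_third lk (ltW t'2)) in E.
  have fr : in_region (arc_region (tgt f) L b) (arc (tgt f) L b (3 * t' - 2)).
    by apply: arc_in_region => //; lra.
  rewrite -E in fr.
  (* A common point would force an end of the first edge to lie in the rest of the arc. *)
  have fr' : in_region [set a; src f] (edge a (src f) (3 * t)).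
    by apply: in_region_edge => //; [lra|left|right].
  have [z [[->|->]]] := in_region_disj fr' fr.
    case=> [aE|/eqP|[g gL ga]].
    + by case: fa; rewrite aE; exact: region_tgt.
    + by rewrite (negbTE ab).
    + by have [] := simple_out abL (f := g); rewrite ?inE ?gL ?orbT.
  case=> [/eqP|sb|[g gL gs]].
  + by rewrite (negbTE (adj_neq (src_adj_tgt f))).
  + by apply: fb; rewrite -sb; exact: region_src.
  + move/seteqP: (fdisj _ gL) => [/(_ (src f)) hh _]; apply: hh; split=> //.
    exact: region_src.
have [t2|t2] := lerP (3 * t) 2; last first.
  rewrite (arc_third lk (ltW t2)) (arc_third lk); last by lra.
  by apply: IH => //; [lra|lra|lra|rewrite (_ : _ - _ = d) // -dE; lra].
rewrite (arc_second _ _ af (ltW t1) t2).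
have [t'2|t'2] := lerP (3 * t') 2.
  rewrite (arc_second _ _ af) //; last by lra.
  rewrite !traverse_arc; apply: IH; [exact: simple_kids|lra|lra|lra|].
  by rewrite (_ : _ - _ = d) // -dE; lra.
rewrite (arc_third lk (ltW t'2)) => E.
have fr : in_region (region f) (traverse f (3 * t - 1)).
  by apply: traverse_in_region; lra.
have rr : in_region (arc_region (tgt f) L b) (traverse f (3 * t - 1)).
  by rewrite E; apply: arc_in_region => //; lra.
(* The region of [f] and the rest of the arc share only [tgt f], where the rest starts; but [t'] is
   later than that start. *)
have : traverse f (3 * t - 1) = vertex (tgt f).
  apply: in_region_singleton fr rr _ => z [fz [-> //|zb|[g gL gz]]].
    by case: fb; rewrite -zb.
  by move/seteqP: (fdisj _ gL) => [/(_ z) hh _]; case: hh.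
rewrite E => /(arc_eq_start fL) E'; have := E' _; lra.
Qed.

Lemma traverse_inj e t t' : 0 <= t <= 1 -> 0 <= t' <= 1 ->
  traverse e t = traverse e t' -> t = t'.
Proof.
have lt s s' : 0 <= s -> s < s' -> s' <= 1 -> traverse e s <> traverse e s'.
  move=> s0 ss' s'1; rewrite !traverse_arc.
  have [n ns] : exists n, (s' - s)^-1 < 3 ^+ n.
    exists (Num.trunc (s' - s)^-1).+1; apply: lt_le_trans (truncnS_gt _) _.
    by rewrite -natrX ler_nat ltnW // ltn_expl.
  apply: (@arc_lt_neq n) => //; first exact: simple_kids.
  by rewrite -ltr_pdivrMr ?div1r //; lra.
move=> t01 t'01 E; case: (ltgtP t t') => // h; exfalso.
  by apply: (lt t t') E => //; lra.
by apply: (lt t' t) (esym E) => //; lra.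
Qed.

(** An inner point of the root edge has nonzero coordinates at both of its ends, whereas with a kid
    present each piece of the arc misses one of them. This allows the root edge to close the
    circle. *)
Lemma traverse_neq_edge e t s : kids e != [::] -> 0 <= t <= 1 -> 0 < s < 1 ->
  traverse e t <> edge (src e) (tgt e) s.
Proof.
move=> eL t01 s01 E; have ee := src_adj_tgt e.
have := congr1 (weight (src e)) E; have := congr1 (weight (tgt e)) E.
have nst := adj_neq ee.
rewrite !weight_edge_point ?eqxx //; try lra.
rewrite [tgt e == src e]eq_sym (negbTE nst) => wt ws.
rewrite traverse_arc in wt ws.
have := simple_kids e; case: (kids e) eL wt ws => // f L _ wt ws abL.
have [af fL fdisj [fa fb] ab] := simple_cons abL.
have lk := simple_linked abL.
have [t1|t1] := lerP (3 * t) 1.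
  move: wt; rewrite (arc_first _ _ _ _ t1) weight_edge_point //; last by lra.
  rewrite [tgt e == src e]eq_sym (negbTE nst); case: eqP => [bf|_]; last by lra.
  by case: fb; rewrite bf; exact: region_src.
have [t2|t2] := lerP (3 * t) 2.
  rewrite (arc_second _ _ af (ltW t1) t2) in ws.
  case: fa; apply: (in_region_weight (traverse_in_region f (t := 3 * t - 1) _)).
    by lra.
  by rewrite ws; lra.
rewrite (arc_third lk (ltW t2)) in ws.
have : arc_region (tgt f) L (tgt e) (src e).
  apply: in_region_weight (arc_in_region (t := 3 * t - 2) (simple_linked fL) _) _; first by lra.
  by rewrite ws; lra.
case=> [aE|/eqP|[g gL ga]].
+ by case: fa; rewrite aE; exact: region_tgt.
+ by rewrite (negbTE ab).
+ by have [] := simple_out abL (f := g); rewrite ?inE ?gL ?orbT.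
Qed.

Lemma traverse_visits n e v : visits (@src _ _ T) (@tgt _ _ T) (@kids _ _ T) n e v ->
  exists2 t, 0 <= t <= 1 & traverse e t = vertex v.
Proof.
have ends e' : (exists2 t, 0 <= t <= 1 & traverse e' t = vertex (src e')) /\
    (exists2 t, 0 <= t <= 1 & traverse e' t = vertex (tgt e')).
  by split; [exists 0; [lra|exact: traverse0]|exists 1; [lra|exact: traverse1]].
have arcs f s a L b : linkedT a L b -> f \in L -> 0 <= s <= 1 ->
    exists2 t, 0 <= t <= 1 & arc a L b t = traverse f s.
  move=> + + s01; elim: L a => // g L IH a ab; have [ag gL] := ab.
  rewrite inE => /orP[/eqP ->|/(IH _ gL)[t t01 <-]].
    (* This inverts the rescaling of the second third; the witness below inverts that of the
       last. *)
    exists ((s + 1) / 3); first by lra.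
    by rewrite arc_second //; [congr traverse; lra|lra|lra].
  by exists ((t + 2) / 3); [lra|rewrite arc_third //; [congr arc; lra|lra]].
elim: n e => [|n IH] e.
  by case=> // ->; have [] := ends e.
case=> [->|->|[f fe /IH[s s01 <-]]]; [by have [] := ends e|by have [] := ends e|].
have [t t01 tE] := arcs f s _ _ _ (kids_linked e) fe s01.
by exists t; rewrite // traverse_arc.
Qed.

End Traversal.

(** * The circle *)

(** Closed subsets of [A] are compact, so their images are compact and hence closed in [T]; this
    makes the inverse continuous. *)
Lemma compact_homeomorphic_image (S T : topologicalType) (f : S -> T) (A : set S) :
  A !=set0 -> compact A -> hausdorff_space T -> {within A, continuous f} ->
  {in A &, injective f} -> homeomorphic_sets A (f @` A).
Proof.
move=> [x0 Ax0] Aco Th fcont finj.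
pose g y := xget x0 [set x | A x /\ f x = y].
have gP y : (f @` A) y -> A (g y) /\ f (g y) = y.
  move=> [x Ax fx]; apply: (@xgetPex _ x0 [set x | A x /\ f x = y]).
  by exists x.
have gf x : A x -> g (f x) = x.
  move=> Ax; have [Ag fg] := gP (f x) (imageP f Ax).
  by apply: finj; rewrite ?inE.
exists f, g; split=> //.
- by split=> [x Ax|y /gP[]//]; exact: imageP.
- split=> [x|y]; rewrite inE; first exact: gf.
  by move=> /gP[].
apply/continuous_closedP => D Dcl; apply/closed_subspaceP.
exists (f @` (A `&` D)).
  apply: compact_closed => //; apply: continuous_compact.
    by apply: continuous_subspaceW fcont => x [].
  by apply: compact_closedI.
apply/seteqP; split=> y.
  move=> [[x [Ax Dx] <-] _]; split; last by exists x.
  by have -> : (g @^-1` D) (f x) = D (g (f x)) by []; rewrite gf.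
move=> [Dg fAy]; split=> //; have [Ag fg] := gP y fAy.
by exists (g y).
Qed.

Section UnitCircle.
Context (R : realType).
Local Open Scope ring_scope.

Lemma unit_circle_fst (z : R * R) :
  unit_circle z -> -1 <= z.1 <= 1.
Proof.
move=> zC; rewrite -ler_norml -(@ler_pXn2r _ 2) ?nnegrE //.
by rewrite -normrX ger0_norm ?sqr_ge0 // expr1n -zC lerDl sqr_ge0.
Qed.

Lemma unit_circle_compact : compact (@unit_circle R).
Proof.
apply: (@subclosed_compact (R * R)%type _ (`[-1, 1]%classic `*` `[-1, 1]%classic)).
- rewrite (_ : @unit_circle R = (fun z : R * R => z.1 * z.1 + z.2 * z.2) @^-1` [set 1]).
    apply: closed_comp; last exact: closed_eq.
    move=> z _; apply: cvgD; apply: cvgM; by [exact: cvg_fst|exact: cvg_snd].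
  by apply/seteqP; split=> z; rewrite /unit_circle /= !expr2.
- by apply: compact_setX; exact: segment_compact.
- move=> z zC; split; rewrite /= in_itv /=; first exact: unit_circle_fst.
  apply: (@unit_circle_fst (z.2, z.1)); rewrite /unit_circle /= addrC; exact: zC.
Qed.

End UnitCircle.

Section Circle.
Local Open Scope ring_scope.
Context (R : realType) {V : choiceType} (H : graph V) (T : arc_tree H).
Variable root : node T.
Hypothesis kids_root : kids root != [::].

(* Both half circles are parametrized by the first coordinate. *)
Definition half_time (z : R * R) : R := (1 + z.1) / 2.

Definition loop (z : R * R) : freudenthal R H :=
  if 0 <= z.2 then traverse root (half_time z)
  else edge_point H (src root) (tgt root) (half_time z).

Lemma half_time01 z : unit_circle z -> 0 <= half_time z <= 1.
Proof. by move=> /unit_circle_fst; rewrite /half_time; lra. Qed.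

Lemma loop_inj : {in @unit_circle R &, injective loop}.
Proof.
have fst_eq z z' : half_time z = half_time z' -> z.1 = z'.1.
  by rewrite /half_time => h; lra.
have lower z : unit_circle z -> z.2 < 0 -> 0 < half_time z < 1.
  move=> zC z2; have : `|z.1| < 1.
    rewrite -(@ltr_pXn2r _ 2) ?nnegrE // -normrX ger0_norm ?sqr_ge0 // expr1n -zC.
    by rewrite ltrDl exprn_even_gt0 //= lt_eqF.
  by rewrite ltr_norml /half_time; lra.
have eqz z z' : unit_circle z -> unit_circle z' -> z.1 = z'.1 ->
    (0 <= z.2) = (0 <= z'.2) -> z = z'.
  case: z z' => [a b] [a' b'] /= zC z'C E; rewrite /unit_circle /= in zC z'C.
  subst a'; move=> bb'; congr pair.
  have /eqP : b ^+ 2 = b' ^+ 2 by lra.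
  rewrite eqf_sqr => /orP[/eqP //|/eqP bE]; move: bb'; rewrite bE oppr_ge0.
  by case: (ltgtP b' 0) => // ->; rewrite oppr0.
move=> z z'; rewrite !inE => zC z'C; rewrite /loop.
case: (lerP 0 z.2) => z2; case: (lerP 0 z'.2) => z'2 E.
- apply: eqz => //; last by rewrite z2 z'2.
  by apply: fst_eq; apply: traverse_inj E; exact: half_time01.
- by case: (traverse_neq_edge kids_root (half_time01 zC) (lower _ z'C z'2)).
- by case: (traverse_neq_edge kids_root (half_time01 z'C) (lower _ zC z2)).
- apply: eqz => //; last by rewrite !leNgt z2 z'2.
  apply: fst_eq; apply: edge_point_inj E; first exact: src_adj_tgt.
    exact: half_time01.
  exact: half_time01.
Qed.

Lemma loop_upper z : 0 <= z.2 -> loop z = traverse root (half_time z).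
Proof. by rewrite /loop => ->. Qed.

(** The two formulas agree at [(1, 0)] and [(-1, 0)], so each holds on a closed half circle and
    continuity can be pasted. *)
Lemma loop_lower z : unit_circle z -> z.2 <= 0 ->
  loop z = edge_point H (src root) (tgt root) (half_time z).
Proof.
move=> zC; have ee := src_adj_tgt root; rewrite le_eqVlt => /orP[/eqP z2|z2].
  rewrite /loop z2 lexx; have : z.1 ^+ 2 == 1.
    by rewrite -[X in _ == X]zC z2 expr0n addr0.
  rewrite sqrf_eq1 /half_time => /orP[] /eqP ->.
    rewrite (_ : (1 + 1) / 2 = 1 :> R); last by lra.
    by rewrite traverse1 edge_point1.
  by rewrite subrr mul0r traverse0 edge_point0.
by rewrite /loop leNgt z2.
Qed.

Lemma loop_continuous : {within @unit_circle R, continuous loop}.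
Proof.
apply/subspace_continuousP => z zC U; rewrite nbhsE => -[W [Wo Wz] WU].
have t01 := half_time01 zC.
have near_time (F : R -> freudenthal R H) : unit_continuous_at F (half_time z) ->
    W (F (half_time z)) ->
    \forall z' \near z, unit_circle z' -> W (F (half_time z')).
  move=> Fc FW; have [c c0 cW] := Fc W Wo FW.
  have z1 : \forall z' \near z, `|z.1 - z'.1| < c.
    have : (fun z' : R * R => z'.1) @ z --> z.1 by exact: cvg_fst.
    by move=> /cvgrPdist_lt; apply.
  apply: filterS z1 => z' zz' z'C; apply: cW; first exact: half_time01.
  by move: zz'; rewrite /half_time !ltr_norml; lra.
have snd_near : (fun z' : R * R => z'.2) @ z --> z.2 by exact: cvg_snd.
have upper : \forall z' \near z, unit_circle z' -> 0 <= z'.2 -> U (loop z').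
  have [z2|z2] := lerP 0 z.2; last first.
    have : \forall z' \near z, z'.2 < 0 by exact: (cvgr_lt z.2 snd_near _ z2).
    by apply: filterS => z' z'2 _; rewrite leNgt z'2.
  have : \forall z' \near z, unit_circle z' -> W (traverse root (half_time z')).
    by apply: near_time; [exact: traverse_continuous|rewrite -loop_upper].
  apply: filterS => z' h z'C z'2; apply: WU; rewrite loop_upper //; exact: h.
have lower : \forall z' \near z, unit_circle z' -> z'.2 <= 0 -> U (loop z').
  have [z2|z2] := lerP z.2 0; last first.
    have : \forall z' \near z, 0 < z'.2 by exact: (cvgr_gt z.2 snd_near _ z2).
    by apply: filterS => z' z'2 _; rewrite leNgt z'2.
  have : \forall z' \near z, unit_circle z' ->
      W (edge_point H (src root) (tgt root) (half_time z')).
    apply: near_time; last by rewrite -loop_lower.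
    by apply: edge_point_continuous => //; exact: src_adj_tgt.
  apply: filterS => z' h z'C z'2; apply: WU; rewrite loop_lower //; exact: h.
move: upper lower; apply: filterS2 => z' h h' z'C.
by have [/h|/ltW/h'] := lerP 0 z'.2; exact.
Qed.

Lemma arc_tree_hamiltonian_circle : region root = setT ->
  (forall x, finite_set [set y | H x y]) ->
  exists C : set (freudenthal R H), hamiltonian_circle C.
Proof.
move=> rootT lf; exists (loop @` @unit_circle R); split.
  apply: compact_homeomorphic_image.
  - by exists (1, 0); rewrite /unit_circle /= expr1n expr0n addr0.
  - exact: unit_circle_compact.
  - exact: freudenthal_hausdorff.
  - exact: loop_continuous.
  - exact: loop_inj.
move=> v; have [n] : exists n, visits (@src _ _ T) (@tgt _ _ T) (@kids _ _ T) n root v.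
  by apply: region_visits; rewrite rootT.
move=> /(traverse_visits R)[t t01 <-].
have s0 : 0 <= 1 - (2 * t - 1) ^+ 2.
  by rewrite subr_ge0 expr2; nra.
(* The point of the upper half circle whose [half_time] is [t]. *)
exists (2 * t - 1, Num.sqrt (1 - (2 * t - 1) ^+ 2)).
  by rewrite /unit_circle /= sqr_sqrtr // addrC subrK.
by rewrite /loop /= sqrtr_ge0 /half_time /=; congr traverse; lra.
Qed.

End Circle.

Theorem theorem1p5 (R : realType) (V : choiceType) (G : graph V) :
  connected_graph G ->
  infinite_set [set: V] ->
  locally_finite G ->
  bipartite G ->
  (exists M : rel V, perfect_matching G M) ->
  exists C : set (freudenthal R (bipower G 3)), hamiltonian_circle C.
Proof.
move=> conn Vinf lf bip [M [Msym MG Muniq]].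
have /choice[m mM] : forall x, exists y, M x y /\ forall y', M x y' -> y' = y.
  by move=> x; have [y [xy yu]] := Muniq x; exists y; split=> // y' /yu.
have mG x : G x (m x) by apply: MG; exact: (mM x).1.
have mK : involutive m.
  by move=> x; apply/esym; apply: (mM (m x)).2; rewrite Msym; exact: (mM x).1.
have [idx idx_inj] := connected_countable conn lf.
have [x0 _] : exists x : V, True.
  apply: contrapT => V0; apply: Vinf; rewrite (_ : setT = set0); first exact: finite_set0.
  by apply/seteqP; split=> // x _; case: V0; exists x.
(* The whole vertex set has empty outer boundary, so any matching edge can serve as its root
   edge. *)
have rootP : matched_region G m (setT, x0, m x0).
  split=> //; rewrite (_ : outer_boundary _ _ = set0); first exact: finite_set0.
  by apply/seteqP; split=> // x [[]].
pose T := matching_tree lf bip mG mK idx_inj.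
pose root : region_node G m := exist _ (setT, x0, m x0) (asboolT rootP).
apply: (@arc_tree_hamiltonian_circle R V _ T root) => //; last first.
  by move=> x; exact: bipower_nbr_finite.
(* A root without kids visits only the two ends of its edge. *)
apply/eqP => kids0; apply: Vinf.
apply: (@sub_finite_set _ _ [set x0; m x0]); last exact: finite_set2.
have kid0 f : f \notin @kids _ _ T root by rewrite kids0.
move=> v _; have [n] := @region_visits _ _ T root v I.
case: n => [|n] /=.
  by case=> // ->; [left|right].
by case=> [->|->|[f]]; [left|right|have /negP := kid0 f].
Qed.
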